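(* Let $(\mathcal{A},\tau,M,\mathfrak{a}_{\mathcal{A}})$ and $(\mathcal{B},\kappa,M,\mathfrak{a}_{\mathcal{B}})$ be two $3$-anchored bundles over the same base manifold $M$, and let $$\phi:\wedge^3\Gamma(\mathcal{A})\to\Gamma(\mathcal{A}),\quad \zeta:\wedge^3\Gamma(\mathcal{A})\to\Gamma(\mathcal{B}),\quad \psi:\wedge^3\Gamma(\mathcal{B})\to\Gamma(\mathcal{A}),\quad \theta:\wedge^3\Gamma(\mathcal{B})\to\Gamma(\mathcal{B}),$$ $$\rho:\Gamma(\mathcal{B})\wedge\Gamma(\mathcal{B})\otimes\Gamma(\mathcal{A})\to\Gamma(\mathcal{A}),\qquad \sigma:\Gamma(\mathcal{B})\otimes\Gamma(\mathcal{A})\wedge\Gamma(\mathcal{A})\to\Gamma(\mathcal{B})$$ be $\mathbb{R}$-trilinear maps, where $\phi,\zeta,\psi,\theta$ are skew-symmetric, $\rho$ is skew-symmetric in its two $\mathcal{B}$-arguments and $\sigma$ is skew-symmetric in its two $\mathcal{A}$-arguments. On the Whitney sum $\mathcal{A}\times\mathcal{B}$ consider the $3$-anchor $$\mathfrak{a}_{\mathcal{A}\times\mathcal{B}}\big((X_1,\eta_1)\wedge(X_2,\eta_2)\big)=\mathfrak{a}_{\mathcal{A}}(X_1\wedge X_2)+\mathfrak{a}_{\mathcal{B}}(\eta_1\wedge\eta_2)$$ and the bracket $[(X_1,\eta_1),(X_2,\eta_2),(X_3,\eta_3)]_{{}_{\zeta}\bowtie_{\psi}}=(\widetilde X,\widetilde\eta)$,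 where $$\widetilde X=\phi(X_1,X_2,X_3)+\psi(\eta_1,\eta_2,\eta_3)+\rho(\eta_2,\eta_3,X_1)-\rho(\eta_1,\eta_3,X_2)+\rho(\eta_1,\eta_2,X_3),$$ $$\widetilde\eta=\theta(\eta_1,\eta_2,\eta_3)+\zeta(X_1,X_2,X_3)+\sigma(\eta_3,X_1,X_2)-\sigma(\eta_2,X_1,X_3)+\sigma(\eta_1,X_2,X_3).$$ Then $\mathcal{A}\times\mathcal{B}$ with the anchor $\mathfrak{a}_{\mathcal{A}\times\mathcal{B}}$ and the bracket $[\bullet,\bullet,\bullet]_{{}_{\zeta}\bowtie_{\psi}}$ is a $3$-Lie algebroid if and only if all of the following conditions hold for all $X,X_i\in\Gamma(\mathcal{A})$, all $\eta,\eta_i\in\Gamma(\mathcal{B})$ and all $f\in C^\infty(M)$. (I) Anchor conditions: \begin{align*} &[\mathfrak{a}_{\mathcal{A}}(X_1\wedge X_2),\mathfrak{a}_{\mathcal{A}}(X_3\wedge X_4)]=\mathfrak{a}_{\mathcal{A}}(\phi(X_1,X_2,X_3)\wedge X_4)+\mathfrak{a}_{\mathcal{A}}(X_3\wedge\phi(X_1,X_2,X_4)),\\ &\mathfrak{a}_{\mathcal{B}}(\zeta(X_1,X_2,X_3)\wedge\eta_4)=0,\\ &[\mathfrak{a}_{\mathcal{A}}(X_1\wedge X_2),\mathfrak{a}_{\mathcal{B}}(\eta_3\wedge\eta_4)]=\mathfrak{a}_{\mathcal{B}}(\sigma(\eta_3,X_1,X_2)\wedge\eta_4)+\mathfrak{a}_{\mathcal{B}}(\eta_3\wedge\sigma(\eta_4,X_1,X_2)),\\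 &\mathfrak{a}_{\mathcal{B}}(\sigma(\eta_2,X_1,X_3)\wedge\eta_4)-\mathfrak{a}_{\mathcal{A}}(X_3\wedge\rho(\eta_2,\eta_4,X_1))=0,\\ &[\mathfrak{a}_{\mathcal{B}}(\eta_1\wedge\eta_2),\mathfrak{a}_{\mathcal{A}}(X_3\wedge X_4)]=\mathfrak{a}_{\mathcal{A}}(\rho(\eta_1,\eta_2,X_3)\wedge X_4)+\mathfrak{a}_{\mathcal{A}}(X_3\wedge\rho(\eta_1,\eta_2,X_4)),\\ &\mathfrak{a}_{\mathcal{A}}(X_3\wedge\psi(\eta_1,\eta_2,\eta_4))=0,\\ &[\mathfrak{a}_{\mathcal{B}}(\eta_1\wedge\eta_2),\mathfrak{a}_{\mathcal{B}}(\eta_3\wedge\eta_4)]=\mathfrak{a}_{\mathcal{B}}(\theta(\eta_1,\eta_2,\eta_3)\wedge\eta_4)+\mathfrak{a}_{\mathcal{B}}(\eta_3\wedge\theta(\eta_1,\eta_2,\eta_4)). \end{align*} (II) Five sections of the same bundle: \begin{align*} &\phi(X_1,X_2,\phi(X_3,X_4,X_5))=\phi(\phi(X_1,X_2,X_3),X_4,X_5)+\phi(X_3,\phi(X_1,X_2,X_4),X_5)+\phi(X_3,X_4,\phi(X_1,X_2,X_5)),\\ &\zeta(X_1,X_2,\phi(X_3,X_4,X_5))+\sigma(\zeta(X_3,X_4,X_5),X_1,X_2)\\ &\quad=\zeta(\phi(X_1,X_2,X_3),X_4,X_5)+\sigma(\zeta(X_1,X_2,X_3),X_4,X_5)\\ &\qquad+\zeta(X_3,\phi(X_1,X_2,X_4),X_5)-\sigma(\zeta(X_1,X_2,X_4),X_3,X_5)\\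 &\qquad+\zeta(X_3,X_4,\phi(X_1,X_2,X_5))+\sigma(\zeta(X_1,X_2,X_5),X_3,X_4),\\ &\theta(\eta_1,\eta_2,\theta(\eta_3,\eta_4,\eta_5))=\theta(\theta(\eta_1,\eta_2,\eta_3),\eta_4,\eta_5)+\theta(\eta_3,\theta(\eta_1,\eta_2,\eta_4),\eta_5)+\theta(\eta_3,\eta_4,\theta(\eta_1,\eta_2,\eta_5)),\\ &\psi(\eta_1,\eta_2,\theta(\eta_3,\eta_4,\eta_5))+\rho(\eta_1,\eta_2,\psi(\eta_3,\eta_4,\eta_5))\\ &\quad=\psi(\theta(\eta_1,\eta_2,\eta_3),\eta_4,\eta_5)+\rho(\eta_4,\eta_5,\psi(\eta_1,\eta_2,\eta_3))\\ &\qquad+\psi(\eta_3,\theta(\eta_1,\eta_2,\eta_4),\eta_5)-\rho(\eta_3,\eta_5,\psi(\eta_1,\eta_2,\eta_4))\\ &\qquad+\psi(\eta_3,\eta_4,\theta(\eta_1,\eta_2,\eta_5))+\rho(\eta_3,\eta_4,\psi(\eta_1,\eta_2,\eta_5)). \end{align*} (III) Four sections of $\mathcal{A}$ and one of $\mathcal{B}$: \begin{align*} &\sigma(\sigma(\eta_5,X_3,X_4),X_1,X_2)=\sigma(\eta_5,\phi(X_1,X_2,X_3),X_4)+\sigma(\eta_5,X_3,\phi(X_1,X_2,X_4))+\sigma(\sigma(\eta_5,X_1,X_2),X_3,X_4),\\ &\rho(\zeta(X_1,X_2,X_3),\eta_5,X_4)-\rho(\zeta(X_1,X_2,X_4),\eta_5,X_3)=0,\\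 &\sigma(\eta_2,X_1,\phi(X_3,X_4,X_5))=\sigma(\sigma(\eta_2,X_1,X_3),X_4,X_5)-\sigma(\sigma(\eta_2,X_1,X_4),X_3,X_5)+\sigma(\sigma(\eta_2,X_1,X_5),X_3,X_4),\\ &\rho(\eta_2,\zeta(X_3,X_4,X_5),X_1)=0. \end{align*} (IV) Three sections of $\mathcal{A}$ and two of $\mathcal{B}$: \begin{align*} &\phi(X_1,X_2,\rho(\eta_4,\eta_5,X_3))=\psi(\zeta(X_1,X_2,X_3),\eta_4,\eta_5)+\rho(\eta_4,\eta_5,\phi(X_1,X_2,X_3))\\ &\qquad+\rho(\sigma(\eta_4,X_1,X_2),\eta_5,X_3)+\rho(\eta_4,\sigma(\eta_5,X_1,X_2),X_3),\\ &\zeta(X_1,X_2,\rho(\eta_4,\eta_5,X_3))=\theta(\zeta(X_1,X_2,X_3),\eta_4,\eta_5),\\ &\rho(\eta_2,\sigma(\eta_5,X_3,X_4),X_1)=\rho(\sigma(\eta_2,X_1,X_3),\eta_5,X_4)-\rho(\sigma(\eta_2,X_1,X_4),\eta_5,X_3)+\phi(X_3,X_4,\rho(\eta_2,\eta_5,X_1)),\\ &\zeta(X_3,X_4,\rho(\eta_2,\eta_5,X_1))=0,\\ &\rho(\eta_1,\eta_2,\phi(X_3,X_4,X_5))+\psi(\eta_1,\eta_2,\zeta(X_3,X_4,X_5))\\ &\quad=\phi(\rho(\eta_1,\eta_2,X_3),X_4,X_5)+\phi(X_3,\rho(\eta_1,\eta_2,X_4),X_5)+\phi(X_3,X_4,\rho(\eta_1,\eta_2,X_5)),\\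 &\theta(\eta_1,\eta_2,\zeta(X_3,X_4,X_5))=\zeta(\rho(\eta_1,\eta_2,X_3),X_4,X_5)+\zeta(X_3,\rho(\eta_1,\eta_2,X_4),X_5)+\zeta(X_3,X_4,\rho(\eta_1,\eta_2,X_5)). \end{align*} (V) Two sections of $\mathcal{A}$ and three of $\mathcal{B}$: \begin{align*} &\phi(X_1,X_2,\psi(\eta_3,\eta_4,\eta_5))=\psi(\sigma(\eta_3,X_1,X_2),\eta_4,\eta_5)+\psi(\eta_3,\sigma(\eta_4,X_1,X_2),\eta_5)+\psi(\eta_3,\eta_4,\sigma(\eta_5,X_1,X_2)),\\ &\zeta(X_1,X_2,\psi(\eta_3,\eta_4,\eta_5))+\sigma(\theta(\eta_3,\eta_4,\eta_5),X_1,X_2)\\ &\quad=\theta(\sigma(\eta_3,X_1,X_2),\eta_4,\eta_5)+\theta(\eta_3,\sigma(\eta_4,X_1,X_2),\eta_5)+\theta(\eta_3,\eta_4,\sigma(\eta_5,X_1,X_2)),\\ &\sigma(\eta_2,X_1,\rho(\eta_4,\eta_5,X_3))=\theta(\sigma(\eta_2,X_1,X_3),\eta_4,\eta_5)-\sigma(\eta_5,X_3,\rho(\eta_2,\eta_4,X_1))+\sigma(\eta_4,X_3,\rho(\eta_2,\eta_5,X_1)),\\ &\psi(\sigma(\eta_2,X_1,X_3),\eta_4,\eta_5)=0,\\ &\psi(\eta_1,\eta_2,\sigma(\eta_5,X_3,X_4))=\phi(X_3,X_4,\psi(\eta_1,\eta_2,\eta_5)),\\ &\theta(\eta_1,\eta_2,\sigma(\eta_5,X_3,X_4))=\sigma(\eta_5,\rho(\eta_1,\eta_2,X_3),X_4)+\sigma(\eta_5,X_3,\rho(\eta_1,\eta_2,X_4))\\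 &\qquad+\zeta(X_3,X_4,\psi(\eta_1,\eta_2,\eta_5))+\sigma(\theta(\eta_1,\eta_2,\eta_5),X_3,X_4). \end{align*} (VI) One section of $\mathcal{A}$ and four of $\mathcal{B}$: \begin{align*} &\rho(\eta_2,\theta(\eta_3,\eta_4,\eta_5),X_1)=\rho(\eta_4,\eta_5,\rho(\eta_2,\eta_3,X_1))-\rho(\eta_3,\eta_5,\rho(\eta_2,\eta_4,X_1))+\rho(\eta_3,\eta_4,\rho(\eta_2,\eta_5,X_1)),\\ &\sigma(\eta_2,\psi(\eta_3,\eta_4,\eta_5),X_1)=0,\\ &\rho(\eta_1,\eta_2,\rho(\eta_4,\eta_5,X_3))=\rho(\eta_4,\eta_5,\rho(\eta_1,\eta_2,X_3))+\rho(\theta(\eta_1,\eta_2,\eta_4),\eta_5,X_3)+\rho(\eta_4,\theta(\eta_1,\eta_2,\eta_5),X_3),\\ &\sigma(\eta_5,X_3,\psi(\eta_1,\eta_2,\eta_4))-\sigma(\eta_4,X_3,\psi(\eta_1,\eta_2,\eta_5))=0. \end{align*} (VII) Leibniz-type conditions: \begin{align*} &\phi(X_1,X_2,fX)=f\phi(X_1,X_2,X)+\mathfrak{a}_{\mathcal{A}}(X_1\wedge X_2)(f)X,\\ &\zeta(X_1,X_2,fX)=f\zeta(X_1,X_2,X),\\ &\sigma(f\eta,X_1,X_2)=f\sigma(\eta,X_1,X_2)+\mathfrak{a}_{\mathcal{A}}(X_1\wedge X_2)(f)\eta,\\ &\sigma(\eta_2,X_1,fX)=f\sigma(\eta_2,X_1,X),\\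 &\rho(f\eta,\eta_2,X_1)=f\rho(\eta,\eta_2,X_1),\\ &\rho(\eta_1,\eta_2,fX)=f\rho(\eta_1,\eta_2,X)+\mathfrak{a}_{\mathcal{B}}(\eta_1\wedge\eta_2)(f)X,\\ &\psi(\eta_1,\eta_2,f\eta)=f\psi(\eta_1,\eta_2,\eta),\\ &\theta(\eta_1,\eta_2,f\eta)=f\theta(\eta_1,\eta_2,\eta)+\mathfrak{a}_{\mathcal{B}}(\eta_1\wedge\eta_2)(f)\eta. \end{align*}
   Context: $M$ is a smooth manifold; $\Gamma(E)$ denotes the smooth sections of a (real, smooth) vector bundle $E\to M$. A $3$-anchored bundle $(\mathcal{A},\tau,M,\mathfrak{a}_{\mathcal{A}})$ is a vector bundle $\tau:\mathcal{A}\to M$ together with a map $\mathfrak{a}_{\mathcal{A}}:\Gamma(\mathcal{A})\wedge\Gamma(\mathcal{A})\to\Gamma(TM)$ (i.e. an $\mathbb{R}$-bilinear skew-symmetric map of pairs of sections), called the $3$-anchor. A $3$-Lie algebroid is a $3$-anchored bundle $(\mathcal{A},\tau,M,\mathfrak{a}_{\mathcal{A}})$ together with an $\mathbb{R}$-trilinear skew-symmetric bracket $[\bullet,\bullet,\bullet]:\wedge^3\Gamma(\mathcal{A})\to\Gamma(\mathcal{A})$ such that for all sections $X_i,Y_j,Y$ and all $f\in C^\infty(M)$: (1) $\mathfrak{a}_{\mathcal{A}}([X_1,X_2,Y_1]\wedge Y_2)+\mathfrak{a}_{\mathcal{A}}(Y_1\wedge[X_1,X_2,Y_2])=[\mathfrak{a}_{\mathcal{A}}(X_1\wedge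 X_2),\mathfrak{a}_{\mathcal{A}}(Y_1\wedge Y_2)]$, the right-hand bracket being the Lie bracket of vector fields; (2) (fundamental identity) $[X_1,X_2,[Y_1,Y_2,Y_3]]=[[X_1,X_2,Y_1],Y_2,Y_3]+[Y_1,[X_1,X_2,Y_2],Y_3]+[Y_1,Y_2,[X_1,X_2,Y_3]]$; (3) (Leibniz rule) $[X_1,X_2,fY]=f[X_1,X_2,Y]+\mathfrak{a}_{\mathcal{A}}(X_1\wedge X_2)(f)\,Y$. $\mathcal{A}\times\mathcal{B}$ denotes the Whitney sum (fiberwise direct product) over $M$; its sections are written as pairs $(X,\eta)$ with $X\in\Gamma(\mathcal{A})$ and $\eta\in\Gamma(\mathcal{B})$. When the structure in the claim is a $3$-Lie algebroid, it is called the bicocycle double cross product $3$-Lie algebroid ${\mathcal{A}}_{\zeta}\bowtie_{\psi}\mathcal{B}$. *)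

(* Defs.v *)
From HB Require Import structures.
From mathcomp Require Import all_boot all_order all_algebra.
From mathcomp Require Import all_classical all_reals all_analysis.
From mathcomp Require Import ring.
Set Implicit Arguments.
Unset Strict Implicit.
Unset Printing Implicit Defensive.
Import Order.TTheory GRing.Theory Num.Theory numFieldNormedType.Exports.
Local Open Scope classical_set_scope.
Local Open Scope ring_scope.

Section SmoothRn.
Context {R : realType} {n : nat}.
Implicit Types (U : set 'rV[R]_n) (f g : 'rV[R]_n -> R).

(* For an open set U these are the functions all of whose iterated partial
   derivatives of order <= k exist and are continuous on U. *)
Fixpoint Ck_on (k : nat) U f : Prop :=
  (forall x, U x -> {for x, continuous f}) /\
  match k with
  | 0%N => True
  | k'.+1 => forall i : 'I_n,
      (forall x, U x -> derivable f x (delta_mx 0 i)) /\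
      Ck_on k' U (fun x => 'D_(delta_mx 0 i) f x)
  end.

Definition Cinfty_on U f := forall k, Ck_on k U f.

Lemma Ck_onS k U V f : U `<=` V -> Ck_on k V f -> Ck_on k U f.
Proof.
move=> UV; elim: k f => [|k IH] f [cf H]; split => //; try by move=> x /UV/cf.
move=> i; by have [dg Hk] := H i; split => [x /UV/dg //|]; apply: IH.
Qed.

Lemma Ck_on_local k U f :
  (forall x, U x -> exists2 V, V x & Ck_on k V f) -> Ck_on k U f.
Proof.
elim: k f => [|k IH] f H.
  by split=> // x /H [V Vx [cf _]]; exact: cf.
split=> [x /H [V Vx [cf _]]|i]; first exact: cf.
split=> [x /H [V Vx [_ /(_ i) [df _]]]|]; first exact: df.
by apply: IH => x /H [V Vx [_ /(_ i) [_ ?]]]; exists V.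
Qed.

Lemma Ck_on_down k U f : Ck_on k.+1 U f -> Ck_on k U f.
Proof.
elim: k f => [|k IH] f [cf H]; split => // i.
by have [df Hk] := H i; split => //; apply: IH.
Qed.

Lemma Ck_on_ext k U f g : open U -> (forall x, U x -> f x = g x) ->
  Ck_on k U f -> Ck_on k U g.
Proof.
move=> oU.
have near_fg f' g' x : (forall x, U x -> f' x = g' x) -> U x ->
    \near x, f' x = g' x.
  move=> fg Ux; near=> y; apply: fg; near: y; exact: open_nbhs_nbhs.
have ctn f' g' x : (forall x, U x -> f' x = g' x) -> U x ->
    {for x, continuous f'} -> {for x, continuous g'}.
  move=> fg Ux cf; rewrite /prop_for /continuous_at -(fg _ Ux).
  apply: cvg_trans cf; apply: near_eq_cvg.
  exact: (nbhs_filter (x : 'rV[R]_n)).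
exact: near_fg fg Ux.
elim: k f g => [|k IH] f g fg [cf H].
  by split => // x Ux; apply: (ctn f) => //; exact: cf.
split => [x Ux|i]; first by apply: (ctn f) => //; exact: cf.
have [df Hk] := H i; split => [x Ux|].
  by apply: (@near_eq_derivable _ _ _ f) (df _ Ux); exact: near_fg.
by apply: IH Hk => x Ux; apply: near_eq_derive; exact: near_fg.
Unshelve. all: by end_near.
Qed.

Lemma Ck_on_cst k U (a : R) : Ck_on k U (fun=> a).
Proof.
elim: k a => [|k IH] a; split => //; try by move=> x _; exact: cst_continuous.
move=> i; split => [x _|]; first exact: derivable_cst.
have -> : (fun x => 'D_(delta_mx 0 i) (fun=> a) x) = (fun _ : 'rV[R]_n => 0 : R).
  by apply/funext => x; rewrite derive_cst.
exact: IH.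
Qed.

Lemma Ck_onD k U f g : open U -> Ck_on k U f -> Ck_on k U g ->
  Ck_on k U (f \+ g).
Proof.
move=> oU; elim: k f g => [|k IH] f g [cf Hf] [cg Hg]; split => //;
  try by move=> x Ux; apply: continuousD; [exact: cf|exact: cg].
move=> i; have [df Kf] := Hf i; have [dg Kg] := Hg i; split=> [x Ux|].
  by apply: derivableD; [exact: df|exact: dg].
apply: Ck_on_ext (IH _ _ Kf Kg) => // x Ux /=.
by rewrite deriveD //; [exact: df|exact: dg].
Qed.

Lemma Ck_onM k U f g : open U -> Ck_on k U f -> Ck_on k U g ->
  Ck_on k U (f \* g).
Proof.
move=> oU; elim: k f g => [|k IH] f g.
  by move=> [cf Hf] [cg Hg]; split => // x Ux; apply: continuousM; [exact: cf|exact: cg].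
move=> Cf Cg; move: (Ck_on_down Cf) (Ck_on_down Cg) => Cf' Cg'.
move: Cf Cg => [cf Hf] [cg Hg]; split=> [x Ux|i].
  by apply: continuousM; [exact: cf|exact: cg].
have [df Kf] := Hf i; have [dg Kg] := Hg i; split=> [x Ux|].
  by apply: derivableM; [exact: df|exact: dg].
apply: Ck_on_ext (Ck_onD oU (IH _ _ Cf' Kg) (IH _ _ Cg' Kf)) => // x Ux /=.
by rewrite deriveM //; [exact: df|exact: dg].
Qed.

End SmoothRn.

Record chart (R : realType) (n : nat) (T : topologicalType) := Chart {
  chart_dom : set T;
  chart_img : set 'rV[R]_n;
  chart_map :> T -> 'rV[R]_n;
  chart_inv : 'rV[R]_n -> T;
  chart_dom_open : open chart_dom;
  chart_img_open : open chart_img;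
  chart_map_img : forall p, chart_dom p -> chart_img (chart_map p);
  chart_inv_dom : forall x, chart_img x -> chart_dom (chart_inv x);
  chart_mapK : forall p, chart_dom p -> chart_inv (chart_map p) = p;
  chart_invK : forall x, chart_img x -> chart_map (chart_inv x) = x;
  chart_map_continuous : forall p, chart_dom p -> {for p, continuous chart_map};
  chart_inv_continuous : forall x, chart_img x -> {for x, continuous chart_inv}
}.

Record manifold (R : realType) := Manifold {
  mspace :> topologicalType;
  mdim : nat;
  manifold_hausdorff : hausdorff_space mspace;
  manifold_second_countable : @second_countable mspace;
  atlas : set (chart R mdim mspace);
  atlas_cover : forall p, exists2 c, atlas c & chart_dom c p;
  atlas_compatible : forall c d, atlas c -> atlas d -> forall i,
    Cinfty_on (chart_img c `&` chart_inv c @^-1` chart_dom d)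
      (fun x => d (chart_inv c x) 0 i)
}.

Section SmoothFunctions.
Context {R : realType} {M : manifold R}.
Implicit Types (W : set M) (f g : M -> R).

Definition smooth_on W f := forall c, atlas (m := M) c ->
  Cinfty_on (chart_img c `&` chart_inv c @^-1` W) (f \o chart_inv c).

Lemma chart_open (c : chart R (mdim M) M) W : open W ->
  open (chart_img c `&` chart_inv c @^-1` W).
Proof.
rewrite !openE => oW x [ix Wx]; apply: filterI.
  by have := @chart_img_open _ _ _ c; rewrite openE; exact.
exact: (chart_inv_continuous ix (oW _ Wx)).
Qed.

Lemma smooth_onS W W' f : W `<=` W' -> smooth_on W' f -> smooth_on W f.
Proof.
by move=> WW' sf c ac k; apply: Ck_onS (sf c ac k) => x [? ?]; split=> //; exact: WW'.
Qed.

Lemma smooth_on_local W f :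
  (forall p, W p -> exists2 V, V p & smooth_on V f) -> smooth_on W f.
Proof.
move=> H c ac k; apply: Ck_on_local => x [ix /H [V Vp sf]].
by exists (chart_img c `&` chart_inv c @^-1` V) => //; exact: sf.
Qed.

Lemma smooth_on_ext W f g : open W -> (forall p, W p -> f p = g p) ->
  smooth_on W f -> smooth_on W g.
Proof.
move=> oW fg sf c ac k; apply: Ck_on_ext (sf c ac k); first exact: chart_open.
by move=> x [_ /= /fg].
Qed.

Lemma smooth_on_cst W (a : R) : smooth_on W (fun=> a).
Proof. by move=> c _ k; exact: Ck_on_cst. Qed.

Lemma smooth_onD W f g : open W -> smooth_on W f -> smooth_on W g ->
  smooth_on W (f \+ g).
Proof.
move=> oW sf sg c ac k.
exact: (Ck_onD (chart_open oW) (sf c ac k) (sg c ac k)).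
Qed.

Lemma smooth_onM W f g : open W -> smooth_on W f -> smooth_on W g ->
  smooth_on W (f \* g).
Proof.
move=> oW sf sg c ac k.
exact: (Ck_onM (chart_open oW) (sf c ac k) (sg c ac k)).
Qed.

End SmoothFunctions.

Section SmoothRing.
Context (R : realType) (M : manifold R).

Definition smooth_pred : {pred M -> R} := [pred f | `[< smooth_on setT f >]].

Record Cinfty := SmoothFun {
  Cinfty_fun :> M -> R;
  _ : smooth_pred Cinfty_fun
}.

HB.instance Definition _ := [isSub for Cinfty_fun].
HB.instance Definition _ := [Choice of Cinfty by <:].

Lemma Cinfty_smooth (f : Cinfty) : smooth_on setT f.
Proof. by have := valP f => /asboolP. Qed.

Fact smooth_subring : subring_closed smooth_pred.
Proof.
have cM (f g : M -> R) : smooth_pred f -> smooth_pred g -> smooth_pred (f * g).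
  by move=> /asboolP sf /asboolP sg; apply/asboolP; apply: smooth_onM => //; exact: openT.
have c1 (a : R) : smooth_pred (fun=> a) by apply/asboolP; exact: smooth_on_cst.
split=> [|f g sf sg|f g]; [exact: c1| |exact: cM].
have -> : f - g = f + (fun=> -1) * g.
  by apply/funext => p; rewrite /GRing.add /GRing.mul /= mulN1r.
have /asboolP sN := cM _ _ (c1 (-1)) sg; move: sf => /asboolP sf.
by apply/asboolP; apply: smooth_onD => //; exact: openT.
Qed.
HB.instance Definition _ := GRing.isSubringClosed.Build _ smooth_pred smooth_subring.
HB.instance Definition _ := GRing.SubChoice_isSubComPzRing.Build _ _ Cinfty smooth_subring.

Fact smooth_scaler : GRing.scaler_closed smooth_pred.
Proof.
move=> a f /asboolP sf; apply/asboolP.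
by apply: (@smooth_onM _ _ _ (fun=> a) f) => //; [exact: openT|exact: smooth_on_cst].
Qed.
HB.instance Definition _ := GRing.isScaleClosed.Build R _ smooth_pred smooth_scaler.
HB.instance Definition _ := [SubZmodule_isSubLmodule of Cinfty by <:].

End SmoothRing.

Section VectorFields.
Context (R : realType) (M : manifold R).

Definition derivation_at (p : M) (v : Cinfty M -> R) :=
  scalar v /\ forall f g : Cinfty M, v (f * g) = f p * v g + g p * v f.

(* The tangent space at p is the space of derivations of C^oo(M) at p, and a
   vector field X is smooth when Xf is smooth for every smooth f. *)
Definition vector_field_pred : {pred M -> Cinfty M -> R} := [pred X |
  `[< (forall p, derivation_at p (X p)) /\
      (forall f, smooth_on setT (fun p => X p f)) >]].

Record vector_field := VectorField {
  vf_fun :> M -> Cinfty M -> R;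
  _ : vector_field_pred vf_fun
}.

HB.instance Definition _ := [isSub for vf_fun].
HB.instance Definition _ := [Choice of vector_field by <:].

Fact vector_field_submod : submod_closed vector_field_pred.
Proof.
split=> [|a X Y /asboolP[dX sX] /asboolP[dY sY]]; apply/asboolP; split.
- by move=> p; split=> [a f g|f g] /=; rewrite /GRing.zero /= !mulr0 addr0.
- by move=> f; exact: smooth_on_cst.
- move=> p; have [lX pX] := dX p; have [lY pY] := dY p.
  have E f : (a *: X + Y) p f = a * X p f + Y p f by [].
  by split=> [b f g|f g]; rewrite !E ?lX ?lY ?pX ?pY /=; ring.
- move=> f; apply: smooth_onD (sY f); first exact: openT.
  by apply: smooth_onM (sX f); [exact: openT|exact: smooth_on_cst].
Qed.
HB.instance Definition _ :=
  GRing.isSubmodClosed.Build R _ vector_field_pred vector_field_submod.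
HB.instance Definition _ := [SubChoice_isSubLmodule of vector_field by <:].

Lemma vector_field_derivation (X : vector_field) p : derivation_at p (X p).
Proof. by have /asboolP[] := valP X. Qed.

Lemma vector_field_smooth (X : vector_field) f : smooth_on setT (fun p => X p f).
Proof. by have /asboolP[] := valP X. Qed.

Fact vf_app_subproof (X : vector_field) (f : Cinfty M) :
  smooth_pred (fun p => X p f).
Proof. by apply/asboolP; exact: vector_field_smooth. Qed.

Definition vf_app (X : vector_field) (f : Cinfty M) : Cinfty M :=
  SmoothFun (vf_app_subproof X f).

Fact lie_bracket_subproof (X Y : vector_field) :
  vector_field_pred (fun p f => X p (vf_app Y f) - Y p (vf_app X f)).
Proof.
apply/asboolP; split=> [p|f].
  have appD (Z : vector_field) a f g :
      vf_app Z (a *: f + g) = a *: vf_app Z f + vf_app Z g.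
    by apply/val_inj/funext => q /=; have [-> _] := vector_field_derivation Z q.
  have appM (Z : vector_field) f g :
      vf_app Z (f * g) = f * vf_app Z g + g * vf_app Z f.
    by apply/val_inj/funext => q /=; have [_ ->] := vector_field_derivation Z q.
  have [lX pX] := vector_field_derivation X p.
  have [lY pY] := vector_field_derivation Y p.
  have XD f g : X p (f + g) = X p f + X p g.
    by have := lX 1 f g; rewrite scale1r mul1r.
  have YD f g : Y p (f + g) = Y p f + Y p g.
    by have := lY 1 f g; rewrite scale1r mul1r.
  split=> [a f g|f g]; rewrite ?appD ?appM.
    by rewrite lX lY /=; ring.
  by rewrite XD YD !pX !pY /=; ring.
apply: smooth_on_ext (smooth_onD _ (vector_field_smooth X (vf_app Y f))
  (smooth_onM _ (smooth_on_cst _ (-1)) (vector_field_smooth Y (vf_app X f))));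
  try exact: openT.
by move=> p _ /=; rewrite mulN1r.
Qed.

Definition lie_bracket (X Y : vector_field) : vector_field :=
  VectorField (lie_bracket_subproof X Y).

End VectorFields.

(* A vector bundle is given by its fibres and by local trivializations whose
   transition maps depend smoothly on the base point; these data determine the
   topology and the smooth structure of the total space.  The rank may vary
   from one connected component of M to another. *)
Record vector_bundle (R : realType) (M : manifold R) := VectorBundle {
  fibre :> M -> lmodType R;
  vb_idx : Type;
  vb_dom : vb_idx -> set M;
  vb_rank : vb_idx -> nat;
  vb_triv : forall i p, fibre p -> 'rV[R]_(vb_rank i);
  vb_inv : forall i p, 'rV[R]_(vb_rank i) -> fibre p;
  vb_dom_open : forall i, open (vb_dom i);
  vb_cover : forall p, exists i, vb_dom i p;
  vb_triv_linear : forall i p, vb_dom i p -> linear (@vb_triv i p);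
  vb_trivK : forall i p, vb_dom i p -> cancel (@vb_triv i p) (@vb_inv i p);
  vb_invK : forall i p, vb_dom i p -> cancel (@vb_inv i p) (@vb_triv i p);
  vb_transition : forall i j v k, smooth_on (vb_dom i `&` vb_dom j)
    (fun p => @vb_triv j p (@vb_inv i p v) 0 k)
}.
Arguments vb_triv {R M} E i {p} : rename.
Arguments vb_inv {R M} E i p : rename.

Section Sections.
Context (R : realType) (M : manifold R) (E : vector_bundle M).

Definition smooth_section (s : forall p, E p) := forall i k,
  smooth_on (vb_dom i) (fun p => vb_triv E i (s p) 0 k).

Record section := MkSection {
  section_fun :> forall p, E p;
  sectionP : smooth_section section_fun
}.

Lemma section_ext (X Y : section) : (forall p, X p = Y p) -> X = Y.
Proof.
case: X Y => [X sX] [Y sY] /= XY.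
have {}XY : X = Y by apply: functional_extensionality_dep.
by case: _ / XY sY => sY; congr MkSection; exact: Prop_irrelevance.
Qed.

HB.instance Definition _ := gen_eqMixin section.
HB.instance Definition _ := gen_choiceMixin section.

Fact comb_subproof (f g : Cinfty M) (X Y : section) :
  smooth_section (fun p => f p *: X p + g p *: Y p).
Proof.
move=> i k.
have smD (h : Cinfty M) (Z : section) :
    smooth_on (vb_dom i) (fun p => h p * vb_triv E i (Z p) 0 k).
  apply: (smooth_onM (vb_dom_open i)); last exact: sectionP.
  exact: (smooth_onS (@subsetT _ _) (Cinfty_smooth h)).
apply: smooth_on_ext (smooth_onD (vb_dom_open i) (smD f X) (smD g Y)).
  exact: vb_dom_open.
move=> p ip /=; have lin := vb_triv_linear ip.
have t0 : vb_triv E i (0 : E p) = 0.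
  by have := lin (-1) 0 0; rewrite scaler0 addr0 scaleN1r addNr.
rewrite lin !mxE; congr (_ + _).
by rewrite -[g p *: Y p]addr0 lin t0 addr0 mxE.
Qed.
Definition comb f g X Y := MkSection (comb_subproof f g X Y).

Fact zero_subproof : smooth_section (fun=> 0).
Proof.
move=> i k; apply: smooth_on_ext (smooth_on_cst _ 0).
  exact: vb_dom_open.
move=> p ip /=; have := vb_triv_linear ip (-1) 0 0.
by rewrite scaler0 addr0 scaleN1r addNr => ->; rewrite mxE.
Qed.

Fact add_subproof (X Y : section) : smooth_section (fun p => X p + Y p).
Proof.
have := comb_subproof 1 1 X Y; congr smooth_section.
by apply: functional_extensionality_dep => p /=; rewrite !scale1r.
Qed.

Fact mul_subproof (f : Cinfty M) (X : section) :
  smooth_section (fun p => f p *: X p).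
Proof.
have := comb_subproof f 0 X X; congr smooth_section.
by apply: functional_extensionality_dep => p /=; rewrite scale0r addr0.
Qed.

Fact opp_subproof (X : section) : smooth_section (fun p => - X p).
Proof.
have := mul_subproof (-1) X; congr smooth_section.
by apply: functional_extensionality_dep => p /=; rewrite scaleN1r.
Qed.

Fact scale_subproof (a : R) (X : section) : smooth_section (fun p => a *: X p).
Proof.
have := mul_subproof (a *: (1 : Cinfty M)) X; congr smooth_section.
apply: functional_extensionality_dep => p.
by have -> : (a *: (1 : Cinfty M)) p = a by exact: mulr1.
Qed.

Definition section_zero := MkSection zero_subproof.
Definition section_add X Y := MkSection (add_subproof X Y).
Definition section_opp X := MkSection (opp_subproof X).
Definition section_scale a X := MkSection (scale_subproof a X).

Definition section_mul f X := MkSection (mul_subproof f X).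

Fact section_addA : associative section_add.
Proof. by move=> X Y Z; apply: section_ext => p /=; rewrite addrA. Qed.
Fact section_addC : commutative section_add.
Proof. by move=> X Y; apply: section_ext => p /=; rewrite addrC. Qed.
Fact section_add0 : left_id section_zero section_add.
Proof. by move=> X; apply: section_ext => p /=; rewrite add0r. Qed.
Fact section_addN : left_inverse section_zero section_opp section_add.
Proof. by move=> X; apply: section_ext => p /=; rewrite addNr. Qed.
HB.instance Definition _ := GRing.isZmodule.Build section
  section_addA section_addC section_add0 section_addN.

Fact section_scaleA a b X :
  section_scale a (section_scale b X) = section_scale (a * b) X.
Proof. by apply: section_ext => p /=; rewrite scalerA. Qed.
Fact section_scale1 : left_id 1 section_scale.
Proof. by move=> X; apply: section_ext => p /=; rewrite scale1r. Qed.
Fact section_scaleDr : right_distributive section_scale +%R.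
Proof. by move=> a X Y; apply: section_ext => p /=; rewrite scalerDr. Qed.
Fact section_scaleDl X : {morph section_scale^~ X : a b / a + b}.
Proof. by move=> a b; apply: section_ext => p /=; rewrite scalerDl. Qed.
HB.instance Definition _ := GRing.Zmodule_isLmodule.Build R section
  section_scaleA section_scale1 section_scaleDr section_scaleDl.

End Sections.

Notation "f *s X" := (section_mul f X) (at level 40, left associativity).

Section Whitney.
Context (R : realType) (M : manifold R) (E F : vector_bundle M).

Let wfibre (p : M) : lmodType R := (E p * F p)%type.
Let wdom (ij : vb_idx E * vb_idx F) : set M := vb_dom ij.1 `&` vb_dom ij.2.
Let wrank (ij : vb_idx E * vb_idx F) := (vb_rank ij.1 + vb_rank ij.2)%N.
Let wtriv ij p (u : wfibre p) : 'rV[R]_(wrank ij) :=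
  row_mx (vb_triv E ij.1 u.1) (vb_triv F ij.2 u.2).
Let winv ij p (v : 'rV[R]_(wrank ij)) : wfibre p :=
  (vb_inv E ij.1 p (lsubmx v), vb_inv F ij.2 p (rsubmx v)).

Fact whitney_open ij : open (wdom ij).
Proof. by apply: openI; exact: vb_dom_open. Qed.

Fact whitney_cover p : exists ij, wdom ij p.
Proof.
have [i ip] := vb_cover E p; have [j jp] := vb_cover F p.
by exists (i, j).
Qed.

Fact whitney_linear ij p : wdom ij p -> linear (@wtriv ij p).
Proof.
move=> [ip jp] a u v; rewrite /wtriv /= (vb_triv_linear ip) (vb_triv_linear jp).
by rewrite scale_row_mx add_row_mx.
Qed.

Fact whitney_trivK ij p : wdom ij p -> cancel (@wtriv ij p) (@winv ij p).
Proof.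
move=> [ip jp] [u v]; rewrite /winv /wtriv row_mxKl row_mxKr /=.
by rewrite (vb_trivK ip) (vb_trivK jp).
Qed.

Fact whitney_invK ij p : wdom ij p -> cancel (@winv ij p) (@wtriv ij p).
Proof.
move=> [ip jp] v; rewrite /winv /wtriv /= (vb_invK ip) (vb_invK jp).
exact: hsubmxK.
Qed.

Fact whitney_transition ij kl v k : smooth_on (wdom ij `&` wdom kl)
  (fun p => @wtriv kl p (@winv ij p v) 0 k).
Proof.
have oW : open (wdom ij `&` wdom kl) by apply: openI; exact: whitney_open.
rewrite /wtriv /winv /=; case: (split_ordP k) => k' ->.
  have := @vb_transition _ _ E ij.1 kl.1 (lsubmx v) k'.
  move=> /(@smooth_onS _ _ (wdom ij `&` wdom kl)) H.
  apply: smooth_on_ext (H _) => //; last by move=> p [[? ?] [? ?]].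
  by move=> p _; rewrite row_mxEl.
have := @vb_transition _ _ F ij.2 kl.2 (rsubmx v) k'.
move=> /(@smooth_onS _ _ (wdom ij `&` wdom kl)) H.
apply: smooth_on_ext (H _) => //; last by move=> p [[? ?] [? ?]].
by move=> p _; rewrite row_mxEr.
Qed.

Definition whitney_sum : vector_bundle M :=
  VectorBundle whitney_open whitney_cover whitney_linear whitney_trivK
    whitney_invK whitney_transition.

Fact section_pair_subproof (X : section E) (eta : section F) :
  @smooth_section _ _ whitney_sum (fun p => (X p, eta p)).
Proof.
move=> ij k; rewrite /= /wtriv /=; case: (split_ordP k) => k' ->.
  apply: (@smooth_on_ext _ _ _ (fun p => vb_triv E ij.1 (X p) 0 k')).
  - exact: whitney_open.
  - by move=> p _; rewrite row_mxEl.
  - by apply: smooth_onS (sectionP X k') => p [].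
apply: (@smooth_on_ext _ _ _ (fun p => vb_triv F ij.2 (eta p) 0 k')).
- exact: whitney_open.
- by move=> p _; rewrite row_mxEr.
- by apply: smooth_onS (sectionP eta k') => p [].
Qed.

Fact section_fst_subproof (Z : section whitney_sum) :
  @smooth_section _ _ E (fun p => (Z p).1).
Proof.
move=> i k; apply: smooth_on_local => p ip; have [j jp] := vb_cover F p.
exists (wdom (i, j)) => //.
apply: smooth_on_ext (@sectionP _ _ _ Z (i, j) (lshift _ k)).
  exact: whitney_open.
by move=> q _; rewrite /= /wtriv /= row_mxEl.
Qed.

Fact section_snd_subproof (Z : section whitney_sum) :
  @smooth_section _ _ F (fun p => (Z p).2).
Proof.
move=> j k; apply: smooth_on_local => p jp; have [i ip] := vb_cover E p.
exists (wdom (i, j)) => //.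
apply: smooth_on_ext (@sectionP _ _ _ Z (i, j) (rshift _ k)).
  exact: whitney_open.
by move=> q _; rewrite /= /wtriv /= row_mxEr.
Qed.

Definition section_pair X eta : section whitney_sum :=
  MkSection (section_pair_subproof X eta).
Definition section_fst Z : section E := MkSection (section_fst_subproof Z).
Definition section_snd Z : section F := MkSection (section_snd_subproof Z).

Lemma section_pairK X eta :
  section_fst (section_pair X eta) = X /\ section_snd (section_pair X eta) = eta.
Proof. by split; apply: section_ext. Qed.

Lemma section_pair_eta Z : section_pair (section_fst Z) (section_snd Z) = Z.
Proof. by apply: section_ext => p /=; case: (Z p). Qed.

Lemma section_fst_linear : linear section_fst.
Proof. by move=> a Y Z; apply: section_ext. Qed.

Lemma section_snd_linear : linear section_snd.
Proof. by move=> a Y Z; apply: section_ext. Qed.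

End Whitney.

Section Multilinear.
Context {R : realType}.

Definition bilinear_map (U V W : lmodType R) (h : U -> V -> W) :=
  (forall v, linear (h^~ v)) /\ (forall u, linear (h u)).

Definition trilinear_map (U V W Z : lmodType R) (h : U -> V -> W -> Z) :=
  [/\ forall v w, linear (fun u => h u v w),
      forall u w, linear (fun v => h u v w) &
      forall u v, linear (h u v)].

Definition skew2 (U W : zmodType) (h : U -> U -> W) :=
  forall u v, h u v = - h v u.

Definition skew3 (U W : zmodType) (h : U -> U -> U -> W) :=
  forall u v w, h u v w = - h v u w /\ h u v w = - h u w v.

End Multilinear.

Record anchored_bundle (R : realType) (M : manifold R) := AnchoredBundle {
  ab_bundle :> vector_bundle M;
  anchor : section ab_bundle -> section ab_bundle -> vector_field M;
  anchor_bilinear : bilinear_map anchor;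
  anchor_skew : skew2 anchor
}.

Definition is_3_Lie_algebroid (R : realType) (M : manifold R)
    (A : anchored_bundle M) (br : section A -> section A -> section A -> section A) :=
  [/\ trilinear_map br /\ skew3 br,
      forall X1 X2 Y1 Y2 : section A,
        anchor (br X1 X2 Y1) Y2 + anchor Y1 (br X1 X2 Y2) =
        lie_bracket (anchor X1 X2) (anchor Y1 Y2),
      forall X1 X2 Y1 Y2 Y3 : section A,
        br X1 X2 (br Y1 Y2 Y3) =
        br (br X1 X2 Y1) Y2 Y3 + br Y1 (br X1 X2 Y2) Y3 +
        br Y1 Y2 (br X1 X2 Y3) &
      forall (X1 X2 Y : section A) (f : Cinfty M),
        br X1 X2 (f *s Y) = f *s br X1 X2 Y + vf_app (anchor X1 X2) f *s Y].

Section DoubleCrossProduct.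
Context (R : realType) (M : manifold R) (A B : anchored_bundle M).

Let wanchor (Z1 Z2 : section (whitney_sum A B)) : vector_field M :=
  anchor (section_fst Z1) (section_fst Z2) +
  anchor (section_snd Z1) (section_snd Z2).

Fact whitney_anchor_bilinear : bilinear_map wanchor.
Proof.
have [lA rA] := @anchor_bilinear _ _ A; have [lB rB] := @anchor_bilinear _ _ B.
split=> [Z a Z1 Z2|Z a Z1 Z2].
  rewrite /wanchor (section_fst_linear a Z1) (section_snd_linear a Z1).
  by rewrite lA lB scalerDr addrACA.
rewrite /wanchor (section_fst_linear a Z1) (section_snd_linear a Z1).
by rewrite rA rB scalerDr addrACA.
Qed.

Fact whitney_anchor_skew : skew2 wanchor.
Proof.
by move=> Z1 Z2; rewrite /wanchor anchor_skew [X in _ + X]anchor_skew opprD.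
Qed.

Definition whitney_anchored : anchored_bundle M :=
  AnchoredBundle whitney_anchor_bilinear whitney_anchor_skew.

Context (phi : section A -> section A -> section A -> section A)
  (zeta : section A -> section A -> section A -> section B)
  (psi : section B -> section B -> section B -> section A)
  (theta : section B -> section B -> section B -> section B)
  (rho : section B -> section B -> section A -> section A)
  (sigma : section B -> section A -> section A -> section B).

Definition double_cross_bracket
    (Z1 Z2 Z3 : section whitney_anchored) : section whitney_anchored :=
  let X1 := section_fst Z1 in let eta1 := section_snd Z1 in
  let X2 := section_fst Z2 in let eta2 := section_snd Z2 in
  let X3 := section_fst Z3 in let eta3 := section_snd Z3 in
  section_pair
    (phi X1 X2 X3 + psi eta1 eta2 eta3
     + rho eta2 eta3 X1 - rho eta1 eta3 X2 + rho eta1 eta2 X3)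
    (theta eta1 eta2 eta3 + zeta X1 X2 X3
     + sigma eta3 X1 X2 - sigma eta2 X1 X3 + sigma eta1 X2 X3).

Definition anchor_conditions :=
  (forall X1 X2 X3 X4, lie_bracket (anchor X1 X2) (anchor X3 X4) =
     anchor (phi X1 X2 X3) X4 + anchor X3 (phi X1 X2 X4)) /\
  (forall X1 X2 X3 eta4, anchor (zeta X1 X2 X3) eta4 = 0) /\
  (forall X1 X2 eta3 eta4, lie_bracket (anchor X1 X2) (anchor eta3 eta4) =
     anchor (sigma eta3 X1 X2) eta4 + anchor eta3 (sigma eta4 X1 X2)) /\
  (forall X1 X3 eta2 eta4,
     anchor (sigma eta2 X1 X3) eta4 - anchor X3 (rho eta2 eta4 X1) = 0) /\
  (forall eta1 eta2 X3 X4, lie_bracket (anchor eta1 eta2) (anchor X3 X4) =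
     anchor (rho eta1 eta2 X3) X4 + anchor X3 (rho eta1 eta2 X4)) /\
  (forall X3 eta1 eta2 eta4, anchor X3 (psi eta1 eta2 eta4) = 0) /\
  (forall eta1 eta2 eta3 eta4,
     lie_bracket (anchor eta1 eta2) (anchor eta3 eta4) =
     anchor (theta eta1 eta2 eta3) eta4 + anchor eta3 (theta eta1 eta2 eta4)).

Definition homogeneous_conditions :=
  (forall X1 X2 X3 X4 X5,
     phi X1 X2 (phi X3 X4 X5) =
     phi (phi X1 X2 X3) X4 X5 + phi X3 (phi X1 X2 X4) X5
     + phi X3 X4 (phi X1 X2 X5)) /\
  (forall X1 X2 X3 X4 X5,
     zeta X1 X2 (phi X3 X4 X5) + sigma (zeta X3 X4 X5) X1 X2 =
     zeta (phi X1 X2 X3) X4 X5 + sigma (zeta X1 X2 X3) X4 X5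
     + zeta X3 (phi X1 X2 X4) X5 - sigma (zeta X1 X2 X4) X3 X5
     + zeta X3 X4 (phi X1 X2 X5) + sigma (zeta X1 X2 X5) X3 X4) /\
  (forall eta1 eta2 eta3 eta4 eta5,
     theta eta1 eta2 (theta eta3 eta4 eta5) =
     theta (theta eta1 eta2 eta3) eta4 eta5
     + theta eta3 (theta eta1 eta2 eta4) eta5
     + theta eta3 eta4 (theta eta1 eta2 eta5)) /\
  (forall eta1 eta2 eta3 eta4 eta5,
     psi eta1 eta2 (theta eta3 eta4 eta5) + rho eta1 eta2 (psi eta3 eta4 eta5) =
     psi (theta eta1 eta2 eta3) eta4 eta5 + rho eta4 eta5 (psi eta1 eta2 eta3)
     + psi eta3 (theta eta1 eta2 eta4) eta5 - rho eta3 eta5 (psi eta1 eta2 eta4)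
     + psi eta3 eta4 (theta eta1 eta2 eta5)
     + rho eta3 eta4 (psi eta1 eta2 eta5)).

(* In the names below, AAAAB means four arguments from A and one from B, etc. *)
Definition conditions_AAAAB :=
  (forall X1 X2 X3 X4 eta5,
     sigma (sigma eta5 X3 X4) X1 X2 =
     sigma eta5 (phi X1 X2 X3) X4 + sigma eta5 X3 (phi X1 X2 X4)
     + sigma (sigma eta5 X1 X2) X3 X4) /\
  (forall X1 X2 X3 X4 eta5,
     rho (zeta X1 X2 X3) eta5 X4 - rho (zeta X1 X2 X4) eta5 X3 = 0) /\
  (forall X1 eta2 X3 X4 X5,
     sigma eta2 X1 (phi X3 X4 X5) =
     sigma (sigma eta2 X1 X3) X4 X5 - sigma (sigma eta2 X1 X4) X3 X5
     + sigma (sigma eta2 X1 X5) X3 X4) /\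
  (forall X1 eta2 X3 X4 X5, rho eta2 (zeta X3 X4 X5) X1 = 0).

Definition conditions_AAABB :=
  (forall X1 X2 X3 eta4 eta5,
     phi X1 X2 (rho eta4 eta5 X3) =
     psi (zeta X1 X2 X3) eta4 eta5 + rho eta4 eta5 (phi X1 X2 X3)
     + rho (sigma eta4 X1 X2) eta5 X3 + rho eta4 (sigma eta5 X1 X2) X3) /\
  (forall X1 X2 X3 eta4 eta5,
     zeta X1 X2 (rho eta4 eta5 X3) = theta (zeta X1 X2 X3) eta4 eta5) /\
  (forall X1 eta2 X3 X4 eta5,
     rho eta2 (sigma eta5 X3 X4) X1 =
     rho (sigma eta2 X1 X3) eta5 X4 - rho (sigma eta2 X1 X4) eta5 X3
     + phi X3 X4 (rho eta2 eta5 X1)) /\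
  (forall X1 eta2 X3 X4 eta5, zeta X3 X4 (rho eta2 eta5 X1) = 0) /\
  (forall eta1 eta2 X3 X4 X5,
     rho eta1 eta2 (phi X3 X4 X5) + psi eta1 eta2 (zeta X3 X4 X5) =
     phi (rho eta1 eta2 X3) X4 X5 + phi X3 (rho eta1 eta2 X4) X5
     + phi X3 X4 (rho eta1 eta2 X5)) /\
  (forall eta1 eta2 X3 X4 X5,
     theta eta1 eta2 (zeta X3 X4 X5) =
     zeta (rho eta1 eta2 X3) X4 X5 + zeta X3 (rho eta1 eta2 X4) X5
     + zeta X3 X4 (rho eta1 eta2 X5)).

Definition conditions_AABBB :=
  (forall X1 X2 eta3 eta4 eta5,
     phi X1 X2 (psi eta3 eta4 eta5) =
     psi (sigma eta3 X1 X2) eta4 eta5 + psi eta3 (sigma eta4 X1 X2) eta5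
     + psi eta3 eta4 (sigma eta5 X1 X2)) /\
  (forall X1 X2 eta3 eta4 eta5,
     zeta X1 X2 (psi eta3 eta4 eta5) + sigma (theta eta3 eta4 eta5) X1 X2 =
     theta (sigma eta3 X1 X2) eta4 eta5 + theta eta3 (sigma eta4 X1 X2) eta5
     + theta eta3 eta4 (sigma eta5 X1 X2)) /\
  (forall X1 eta2 X3 eta4 eta5,
     sigma eta2 X1 (rho eta4 eta5 X3) =
     theta (sigma eta2 X1 X3) eta4 eta5 - sigma eta5 X3 (rho eta2 eta4 X1)
     + sigma eta4 X3 (rho eta2 eta5 X1)) /\
  (forall X1 eta2 X3 eta4 eta5, psi (sigma eta2 X1 X3) eta4 eta5 = 0) /\
  (forall eta1 eta2 X3 X4 eta5,
     psi eta1 eta2 (sigma eta5 X3 X4) = phi X3 X4 (psi eta1 eta2 eta5)) /\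
  (forall eta1 eta2 X3 X4 eta5,
     theta eta1 eta2 (sigma eta5 X3 X4) =
     sigma eta5 (rho eta1 eta2 X3) X4 + sigma eta5 X3 (rho eta1 eta2 X4)
     + zeta X3 X4 (psi eta1 eta2 eta5) + sigma (theta eta1 eta2 eta5) X3 X4).

Definition conditions_ABBBB :=
  (forall X1 eta2 eta3 eta4 eta5,
     rho eta2 (theta eta3 eta4 eta5) X1 =
     rho eta4 eta5 (rho eta2 eta3 X1) - rho eta3 eta5 (rho eta2 eta4 X1)
     + rho eta3 eta4 (rho eta2 eta5 X1)) /\
  (forall X1 eta2 eta3 eta4 eta5, sigma eta2 (psi eta3 eta4 eta5) X1 = 0) /\
  (forall eta1 eta2 X3 eta4 eta5,
     rho eta1 eta2 (rho eta4 eta5 X3) =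
     rho eta4 eta5 (rho eta1 eta2 X3) + rho (theta eta1 eta2 eta4) eta5 X3
     + rho eta4 (theta eta1 eta2 eta5) X3) /\
  (forall eta1 eta2 X3 eta4 eta5,
     sigma eta5 X3 (psi eta1 eta2 eta4)
     - sigma eta4 X3 (psi eta1 eta2 eta5) = 0).

Definition leibniz_conditions :=
  (forall X1 X2 X (f : Cinfty M),
     phi X1 X2 (f *s X) = f *s phi X1 X2 X + vf_app (anchor X1 X2) f *s X) /\
  (forall X1 X2 X (f : Cinfty M), zeta X1 X2 (f *s X) = f *s zeta X1 X2 X) /\
  (forall eta X1 X2 (f : Cinfty M),
     sigma (f *s eta) X1 X2 =
     f *s sigma eta X1 X2 + vf_app (anchor X1 X2) f *s eta) /\
  (forall eta2 X1 X (f : Cinfty M),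
     sigma eta2 X1 (f *s X) = f *s sigma eta2 X1 X) /\
  (forall eta eta2 X1 (f : Cinfty M),
     rho (f *s eta) eta2 X1 = f *s rho eta eta2 X1) /\
  (forall eta1 eta2 X (f : Cinfty M),
     rho eta1 eta2 (f *s X) =
     f *s rho eta1 eta2 X + vf_app (anchor eta1 eta2) f *s X) /\
  (forall eta1 eta2 eta (f : Cinfty M),
     psi eta1 eta2 (f *s eta) = f *s psi eta1 eta2 eta) /\
  (forall eta1 eta2 eta (f : Cinfty M),
     theta eta1 eta2 (f *s eta) =
     f *s theta eta1 eta2 eta + vf_app (anchor eta1 eta2) f *s eta).

End DoubleCrossProduct.

(* Main.v *)
Require Import Defs.
From HB Require Import structures.
From mathcomp Require Import all_boot all_order all_algebra.
From mathcomp Require Import all_classical all_reals all_analysis.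

(** Each of the three axioms of a 3-Lie algebroid says that a certain defect
    vanishes: the fundamental defect (five sections), the anchor defect (four)
    and, for a fixed function, the Leibniz defect (three).  For a trilinear
    skew bracket these defects are additive in every argument, skew in the
    first two arguments and, the first two kinds, skew in the remaining ones as
    well ([fundamental_defect_skew345], [anchor_defect_skew34]).

    Every section of the Whitney sum is the sum of a pure section (X, 0) and a
    pure section (0, eta).  By additivity a defect vanishes identically as soon
    as it vanishes on pure arguments, and by skewness only the number of
    A-sections among the first two arguments, and among the remaining ones,
    matters: 3 * 4 = 12 types for the fundamental defect, 3 * 3 = 9 for the
    anchor defect and 3 * 2 = 6 for the Leibniz defect
    ([fundamental_defect_vanish], [anchor_defect_vanish],
    [leibniz_defect_vanish]).

    On pure arguments all but a few terms of the double cross bracket are zero.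
    For each type the vanishing of the defect therefore amounts to a few short
    equations, at most one in each summand, and these are exactly the conditions
    of the proposition: the A- and B-components of the 12 fundamental types are
    the 24 conditions on five sections, seven of the nine anchor types give the
    seven anchor conditions (the types AB,AA and AB,BB hold trivially), and the
    six Leibniz types give the eight Leibniz conditions.  The bracket itself is
    trilinear and skew by the symmetries of its six components. *)

(** * Multilinear skew maps on a sum of two pieces *)

Section MultilinearTheory.
Set Implicit Arguments.
Unset Strict Implicit.
Import GRing.Theory.
Local Open Scope ring_scope.
Context {R : realType}.

Lemma linear_add (U V : lmodType R) (h : U -> V) : linear h ->
  {morph h : x y / x + y}.
Proof. by move=> lh x y; have := lh 1 x y; rewrite !scale1r. Qed.

Lemma linear_zero (U V : lmodType R) (h : U -> V) : linear h -> h 0 = 0.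
Proof.
by move=> /linear_add/(_ 0 0); rewrite addr0 -{1}[h 0]addr0 => /addrI.
Qed.

Lemma linear_opp (U V : lmodType R) (h : U -> V) : linear h ->
  {morph h : x / - x}.
Proof.
move=> lh x; have := lh (-1) x 0; rewrite !scaleN1r (linear_zero lh).
by rewrite !addr0.
Qed.

(** This lemma and those like it below bundle one equation per argument, so
    that a single rewrite rule normalizes all arguments of the map. *)
Lemma trilinear0 (U V W Z : lmodType R) (h : U -> V -> W -> Z) :
  trilinear_map h ->
  ((forall v w, (h 0 v w = 0)%R) * (forall u w, (h u 0 w = 0)%R)
   * (forall u v, (h u v 0 = 0)%R))%type.
Proof.
by case=> l1 l2 l3; split=> [|u v]; [split=> u v|];
  [exact: linear_zero (l1 u v)|exact: linear_zero (l2 u v)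
  |exact: linear_zero (l3 u v)].
Qed.

Lemma trilinearN (U V W Z : lmodType R) (h : U -> V -> W -> Z) :
  trilinear_map h ->
  ((forall u v w, (h (- u) v w = - h u v w)%R)
   * (forall u v w, (h u (- v) w = - h u v w)%R)
   * (forall u v w, (h u v (- w) = - h u v w)%R))%type.
Proof.
by case=> l1 l2 l3; split; [split|] => u v w;
  [exact: linear_opp (l1 v w) u|exact: linear_opp (l2 u w) v
  |exact: linear_opp (l3 u v) w].
Qed.

Lemma trilinearD (U V W Z : lmodType R) (h : U -> V -> W -> Z) :
  trilinear_map h ->
  ((forall u u' v w, (h (u + u') v w = h u v w + h u' v w)%R)
   * (forall u v v' w, (h u (v + v') w = h u v w + h u v' w)%R)
   * (forall u v w w', (h u v (w + w') = h u v w + h u v w')%R))%type.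
Proof.
by case=> l1 l2 l3; split; [split|] => u v w w';
  [exact: linear_add (l1 w w') u v|exact: linear_add (l2 u w') v w
  |exact: linear_add (l3 u v) w w'].
Qed.

Lemma bilinear0 (U V W : lmodType R) (h : U -> V -> W) : bilinear_map h ->
  ((forall v, (h 0 v = 0)%R) * (forall u, (h u 0 = 0)%R))%type.
Proof.
by case=> l1 l2; split=> u;
  [exact: linear_zero (l1 u)|exact: linear_zero (l2 u)].
Qed.

Lemma bilinearN (U V W : lmodType R) (h : U -> V -> W) : bilinear_map h ->
  ((forall u v, (h (- u) v = - h u v)%R)
   * (forall u v, (h u (- v) = - h u v)%R))%type.
Proof.
by case=> l1 l2; split=> u v;
  [exact: linear_opp (l1 v) u|exact: linear_opp (l2 u) v].
Qed.

Lemma bilinearD (U V W : lmodType R) (h : U -> V -> W) : bilinear_map h ->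
  ((forall u u' v, (h (u + u') v = h u v + h u' v)%R)
   * (forall u v v', (h u (v + v') = h u v + h u v')%R))%type.
Proof.
by case=> l1 l2; split=> u v w;
  [exact: linear_add (l1 w) u v|exact: linear_add (l2 u) v w].
Qed.

Section PureArguments.
Context {V W : zmodType} {S T : Type} (iA : S -> W) (iB : T -> W).
(* The elements of the form iA x and iB y are the pure ones. *)
Context (spanAB : forall w, exists x y, w = iA x + iB y).

(** Additivity in the second argument comes from additivity in the first one
    by skewness, which also turns the type BA into AB. *)
Lemma skew2_vanish (F : W -> W -> V) :
  (forall w, {morph F^~ w : x y / x + y}) -> skew2 F ->
  (forall x x', F (iA x) (iA x') = 0) ->
  (forall x y, F (iA x) (iB y) = 0) ->
  (forall y y', F (iB y) (iB y') = 0) ->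
  forall w w', F w w' = 0.
Proof.
move=> add1 skewF AA AB BB w w'.
have BA y x : F (iB y) (iA x) = 0 by rewrite skewF AB oppr0.
have add2 u v v' : F u (v + v') = F u v + F u v'.
  by rewrite skewF add1 opprD -!skewF.
have [x [y ->]] := spanAB w; have [x' [y' ->]] := spanAB w'.
by rewrite add1 !add2 AA AB BA BB !addr0.
Qed.

(** With its first argument pure and fixed, F is skew in the other two, so
    the two-argument case applies; skewness moves a leading iB y to the right
    past every iA x, and only the four types sorted in this way remain. *)
Lemma skew3_vanish (F : W -> W -> W -> V) :
  (forall w w', {morph (fun u => F u w w') : x y / x + y}) -> skew3 F ->
  (forall x1 x2 x3, F (iA x1) (iA x2) (iA x3) = 0) ->
  (forall x1 x2 y3, F (iA x1) (iA x2) (iB y3) = 0) ->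
  (forall x1 y2 y3, F (iA x1) (iB y2) (iB y3) = 0) ->
  (forall y1 y2 y3, F (iB y1) (iB y2) (iB y3) = 0) ->
  forall w1 w2 w3, F w1 w2 w3 = 0.
Proof.
move=> add1 skewF AAA AAB ABB BBB w1 w2 w3.
have swap12 u v w := (skewF u v w).1; have swap23 u v w := (skewF u v w).2.
have [x1 [y1 ->]] := spanAB w1.
have pureA v w : F (iA x1) v w = 0.
  apply: skew2_vanish => // u x y.
  by rewrite swap12 add1 opprD -!swap12.
have pureB v w : F (iB y1) v w = 0.
  apply: skew2_vanish => // [u x y|x x'|x y].
  - by rewrite swap12 add1 opprD -!swap12.
  - by rewrite swap12 swap23 AAB !oppr0.
  - by rewrite swap12 ABB oppr0.
by rewrite add1 pureA pureB addr0.
Qed.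

End PureArguments.

(** * The defect of the fundamental identity *)

Section FundamentalIdentity.
Context {W : lmodType R} (br : W -> W -> W -> W).
Context (br_tri : trilinear_map br) (br_skew : skew3 br).

Definition fundamental_defect Z1 Z2 Y1 Y2 Y3 :=
  br Z1 Z2 (br Y1 Y2 Y3) - (br (br Z1 Z2 Y1) Y2 Y3
    + br Y1 (br Z1 Z2 Y2) Y3 + br Y1 Y2 (br Z1 Z2 Y3)).

Let brD := trilinearD br_tri.
Let brN := trilinearN br_tri.
Let swap12 u v w : br v u w = - br u v w := (br_skew v u w).1.
Let swap23 u v w : br u w v = - br u v w := (br_skew u w v).2.

Let defectD (a a' b b' c c' d d' : W) :
  (a + a') - ((b + b') + (c + c') + (d + d'))
  = (a - (b + c + d)) + (a' - (b' + c' + d')).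
Proof. by rewrite (addrACA b) (addrACA (b + c)) opprD addrACA. Qed.

Lemma fundamental_defect_add1 Z2 Y1 Y2 Y3 :
  {morph (fun Z1 => fundamental_defect Z1 Z2 Y1 Y2 Y3) : x y / x + y}.
Proof. by move=> x y; rewrite /fundamental_defect !brD defectD. Qed.

Lemma fundamental_defect_add3 Z1 Z2 Y2 Y3 :
  {morph (fun Y1 => fundamental_defect Z1 Z2 Y1 Y2 Y3) : x y / x + y}.
Proof. by move=> x y; rewrite /fundamental_defect !brD defectD. Qed.

Lemma fundamental_defect_skew12 Y1 Y2 Y3 :
  skew2 (fun Z1 Z2 => fundamental_defect Z1 Z2 Y1 Y2 Y3).
Proof.
move=> Z1 Z2; rewrite /fundamental_defect.
by rewrite !(swap12 Z2 Z1) !brN -!opprD.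
Qed.

(** Exchanging Y1 and Y2 exchanges the first two of the three subtracted terms
    up to sign, and exchanging Y2 and Y3 the last two. *)
Lemma fundamental_defect_skew345 Z1 Z2 : skew3 (fundamental_defect Z1 Z2).
Proof.
move=> Y1 Y2 Y3; rewrite /fundamental_defect; split.
  rewrite (swap12 Y2 Y1 Y3) (swap12 Y2) (swap12 _ Y1) (swap12 Y2 Y1) brN.
  by rewrite -!opprD [X in _ = - (_ - (X + _))]addrC.
rewrite (swap23 Y1 Y3 Y2) (swap23 _ Y3 Y2) (swap23 Y1 Y3) (swap23 Y1 _ Y2) brN.
by rewrite -!opprD -!addrA [X in _ = - (_ - (_ + X))]addrC.
Qed.

(** The twelve types are those whose first two and last three arguments are
    sorted, A before B. *)
Lemma fundamental_defect_vanish (S T : Type) (iA : S -> W) (iB : T -> W) :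
  (forall w, exists x y, w = iA x + iB y) ->
  let D := fundamental_defect in
  (forall x1 x2 x3 x4 x5, D (iA x1) (iA x2) (iA x3) (iA x4) (iA x5) = 0) ->
  (forall x1 x2 x3 x4 y5, D (iA x1) (iA x2) (iA x3) (iA x4) (iB y5) = 0) ->
  (forall x1 x2 x3 y4 y5, D (iA x1) (iA x2) (iA x3) (iB y4) (iB y5) = 0) ->
  (forall x1 x2 y3 y4 y5, D (iA x1) (iA x2) (iB y3) (iB y4) (iB y5) = 0) ->
  (forall x1 y2 x3 x4 x5, D (iA x1) (iB y2) (iA x3) (iA x4) (iA x5) = 0) ->
  (forall x1 y2 x3 x4 y5, D (iA x1) (iB y2) (iA x3) (iA x4) (iB y5) = 0) ->
  (forall x1 y2 x3 y4 y5, D (iA x1) (iB y2) (iA x3) (iB y4) (iB y5) = 0) ->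
  (forall x1 y2 y3 y4 y5, D (iA x1) (iB y2) (iB y3) (iB y4) (iB y5) = 0) ->
  (forall y1 y2 x3 x4 x5, D (iB y1) (iB y2) (iA x3) (iA x4) (iA x5) = 0) ->
  (forall y1 y2 x3 x4 y5, D (iB y1) (iB y2) (iA x3) (iA x4) (iB y5) = 0) ->
  (forall y1 y2 x3 y4 y5, D (iB y1) (iB y2) (iA x3) (iB y4) (iB y5) = 0) ->
  (forall y1 y2 y3 y4 y5, D (iB y1) (iB y2) (iB y3) (iB y4) (iB y5) = 0) ->
  forall Z1 Z2 Y1 Y2 Y3, D Z1 Z2 Y1 Y2 Y3 = 0.
Proof.
move=> span D D1 D2 D3 D4 D5 D6 D7 D8 D9 D10 D11 D12 Z1 Z2 Y1 Y2 Y3.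
have add3 U V w w' : {morph (fun u => D U V u w w') : x y / x + y}.
  exact: fundamental_defect_add3.
have skew345 U V : skew3 (D U V) by exact: fundamental_defect_skew345.
have AA x x' : D (iA x) (iA x') Y1 Y2 Y3 = 0.
  exact: (skew3_vanish span (add3 _ _) (skew345 _ _)).
have AB x y : D (iA x) (iB y) Y1 Y2 Y3 = 0.
  exact: (skew3_vanish span (add3 _ _) (skew345 _ _)).
have BB y y' : D (iB y) (iB y') Y1 Y2 Y3 = 0.
  exact: (skew3_vanish span (add3 _ _) (skew345 _ _)).
apply: (skew2_vanish span _ (fundamental_defect_skew12 Y1 Y2 Y3) AA AB BB).
by move=> Z; exact: fundamental_defect_add1.
Qed.

End FundamentalIdentity.
End MultilinearTheory.

(** * Calculus of vector fields and sections *)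

Section VectorFieldCalculus.
Set Implicit Arguments.
Unset Strict Implicit.
Import GRing.Theory.
Local Open Scope ring_scope.
Context {R : realType} {M : manifold R}.
Implicit Types (X Y Z : vector_field M) (f g : Cinfty M).

Lemma vf_appDl X Y f : vf_app (X + Y) f = vf_app X f + vf_app Y f.
Proof. exact: val_inj. Qed.

Lemma vf_appNl X f : vf_app (- X) f = - vf_app X f.
Proof. exact: val_inj. Qed.

Lemma vf_app0l f : vf_app (0 : vector_field M) f = 0.
Proof. exact: val_inj. Qed.

Lemma lie_bracketC X Y : lie_bracket X Y = - lie_bracket Y X.
Proof.
apply/val_inj/funext => p; apply/funext => f.
by apply/esym; exact: (opprB (Y p (vf_app X f)) (X p (vf_app Y f))).
Qed.

Lemma lie_bracketDl X Y Z :
  lie_bracket (X + Y) Z = lie_bracket X Z + lie_bracket Y Z.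
Proof.
apply/val_inj/funext => p; apply/funext => f.
rewrite /= vf_appDl.
have [lZ _] := vector_field_derivation Z p.
have -> : Z p (vf_app X f + vf_app Y f) = Z p (vf_app X f) + Z p (vf_app Y f).
  by have := lZ 1 (vf_app X f) (vf_app Y f); rewrite scale1r mul1r.
by rewrite opprD addrACA.
Qed.

Lemma lie_bracketDr X Y Z :
  lie_bracket X (Y + Z) = lie_bracket X Y + lie_bracket X Z.
Proof. by rewrite lie_bracketC lie_bracketDl opprD -!(lie_bracketC X). Qed.

Lemma lie_bracket0l X : lie_bracket 0 X = 0.
Proof.
by apply: (@addrI _ (lie_bracket 0 X)); rewrite -lie_bracketDl !addr0.
Qed.

Lemma lie_bracket0r X : lie_bracket X 0 = 0.
Proof. by rewrite lie_bracketC lie_bracket0l oppr0. Qed.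

Lemma lie_bracketNl X Y : lie_bracket (- X) Y = - lie_bracket X Y.
Proof.
by apply/eqP; rewrite -addr_eq0 -lie_bracketDl addNr lie_bracket0l.
Qed.

Lemma lie_bracketNr X Y : lie_bracket X (- Y) = - lie_bracket X Y.
Proof. by rewrite lie_bracketC lie_bracketNl -(lie_bracketC X). Qed.

Lemma section_mulDr (E : vector_bundle M) f (X Y : section E) :
  f *s (X + Y) = f *s X + f *s Y.
Proof. by apply: section_ext => p; exact: scalerDr. Qed.

Lemma section_mulNr (E : vector_bundle M) f (X : section E) :
  f *s (- X) = - (f *s X).
Proof. by apply: section_ext => p; exact: scalerN. Qed.

Lemma section_mulr0 (E : vector_bundle M) f : f *s (0 : section E) = 0.
Proof. by apply: section_ext => p; exact: scaler0. Qed.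

Lemma section_mulDl (E : vector_bundle M) f g (X : section E) :
  (f + g) *s X = f *s X + g *s X.
Proof. by apply: section_ext => p; exact: scalerDl. Qed.

Lemma section_mulNl (E : vector_bundle M) f (X : section E) :
  (- f) *s X = - (f *s X).
Proof. by apply: section_ext => p; exact: scaleNr. Qed.

Lemma section_mul0r (E : vector_bundle M) (X : section E) : 0 *s X = 0.
Proof. by apply: section_ext => p; exact: scale0r. Qed.

End VectorFieldCalculus.

(** * The defects that involve the anchor *)

Section AlgebroidDefects.
Set Implicit Arguments.
Unset Strict Implicit.
Import GRing.Theory.
Local Open Scope ring_scope.
Context {R : realType} {M : manifold R} {A : anchored_bundle M}.
Context (br : section A -> section A -> section A -> section A).
Context (br_tri : trilinear_map br) (br_skew : skew3 br).

Definition anchor_defect (Z1 Z2 Y1 Y2 : section A) : vector_field M :=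
  anchor (br Z1 Z2 Y1) Y2 + anchor Y1 (br Z1 Z2 Y2)
  - lie_bracket (anchor Z1 Z2) (anchor Y1 Y2).

Definition leibniz_defect (f : Cinfty M) (Z1 Z2 Y : section A) : section A :=
  br Z1 Z2 (f *s Y) - (f *s br Z1 Z2 Y + vf_app (anchor Z1 Z2) f *s Y).

Let aD := bilinearD (@anchor_bilinear _ _ A).
Let aN := bilinearN (@anchor_bilinear _ _ A).
Let aC := @anchor_skew _ _ A.
Let brD := trilinearD br_tri.
Let brN := trilinearN br_tri.
Let swap12 u v w : br v u w = - br u v w := (br_skew v u w).1.

Let defectD (V : zmodType) (a a' b b' c c' : V) :
  (a + a') + (b + b') - (c + c') = (a + b - c) + (a' + b' - c').
Proof. by rewrite (addrACA a) opprD (addrACA (a + b)). Qed.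

Let defectD' (V : zmodType) (a a' b b' c c' : V) :
  (a + a') - ((b + b') + (c + c')) = (a - (b + c)) + (a' - (b' + c')).
Proof. by rewrite (addrACA b) opprD addrACA. Qed.

Lemma anchor_defect_add1 Z2 Y1 Y2 :
  {morph (fun Z1 => anchor_defect Z1 Z2 Y1 Y2) : x y / x + y}.
Proof.
by move=> x y; rewrite /anchor_defect !brD !aD lie_bracketDl defectD.
Qed.

Lemma anchor_defect_add3 Z1 Z2 Y2 :
  {morph (fun Y1 => anchor_defect Z1 Z2 Y1 Y2) : x y / x + y}.
Proof.
by move=> x y; rewrite /anchor_defect !brD !aD lie_bracketDr defectD.
Qed.

Lemma anchor_defect_skew12 Y1 Y2 :
  skew2 (fun Z1 Z2 => anchor_defect Z1 Z2 Y1 Y2).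
Proof.
move=> Z1 Z2; rewrite /anchor_defect !(swap12 Z2 Z1) (aC Z1 Z2).
by rewrite !aN lie_bracketNl -!opprD.
Qed.

Lemma anchor_defect_skew34 Z1 Z2 : skew2 (anchor_defect Z1 Z2).
Proof.
move=> Y1 Y2; rewrite /anchor_defect (aC Y1 Y2) (aC Y1) (aC _ Y2).
by rewrite lie_bracketNr -!opprD [X in _ = - (X - _)]addrC.
Qed.

Lemma leibniz_defect_add1 f Z2 Y :
  {morph (fun Z1 => leibniz_defect f Z1 Z2 Y) : x y / x + y}.
Proof.
move=> x y; rewrite /leibniz_defect !brD !aD vf_appDl section_mulDl.
rewrite section_mulDr; exact: defectD'.
Qed.

Lemma leibniz_defect_add3 f Z1 Z2 :
  {morph leibniz_defect f Z1 Z2 : x y / x + y}.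
Proof.
move=> x y; rewrite /leibniz_defect brD !section_mulDr brD.
exact: defectD'.
Qed.

Lemma leibniz_defect_skew12 f Y :
  skew2 (fun Z1 Z2 => leibniz_defect f Z1 Z2 Y).
Proof.
move=> Z1 Z2; rewrite /leibniz_defect !(swap12 Z2 Z1) (aC Z1 Z2).
by rewrite vf_appNl section_mulNl section_mulNr -!opprD.
Qed.

Lemma anchor_defect_vanish (S T : Type) (iA : S -> section A)
    (iB : T -> section A) :
  (forall Z, exists x y, Z = iA x + iB y) ->
  let D := anchor_defect in
  (forall x1 x2 x3 x4, D (iA x1) (iA x2) (iA x3) (iA x4) = 0) ->
  (forall x1 x2 x3 y4, D (iA x1) (iA x2) (iA x3) (iB y4) = 0) ->
  (forall x1 x2 y3 y4, D (iA x1) (iA x2) (iB y3) (iB y4) = 0) ->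
  (forall x1 y2 x3 x4, D (iA x1) (iB y2) (iA x3) (iA x4) = 0) ->
  (forall x1 y2 x3 y4, D (iA x1) (iB y2) (iA x3) (iB y4) = 0) ->
  (forall x1 y2 y3 y4, D (iA x1) (iB y2) (iB y3) (iB y4) = 0) ->
  (forall y1 y2 x3 x4, D (iB y1) (iB y2) (iA x3) (iA x4) = 0) ->
  (forall y1 y2 x3 y4, D (iB y1) (iB y2) (iA x3) (iB y4) = 0) ->
  (forall y1 y2 y3 y4, D (iB y1) (iB y2) (iB y3) (iB y4) = 0) ->
  forall Z1 Z2 Y1 Y2, D Z1 Z2 Y1 Y2 = 0.
Proof.
move=> span D D1 D2 D3 D4 D5 D6 D7 D8 D9 Z1 Z2 Y1 Y2.
have add3 U V w : {morph (fun u => D U V u w) : x y / x + y}.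
  exact: anchor_defect_add3.
have skew34 U V : skew2 (D U V) by exact: anchor_defect_skew34.
have AA x x' : D (iA x) (iA x') Y1 Y2 = 0.
  exact: (skew2_vanish span (add3 _ _) (skew34 _ _)).
have AB x y : D (iA x) (iB y) Y1 Y2 = 0.
  exact: (skew2_vanish span (add3 _ _) (skew34 _ _)).
have BB y y' : D (iB y) (iB y') Y1 Y2 = 0.
  exact: (skew2_vanish span (add3 _ _) (skew34 _ _)).
apply: (skew2_vanish span _ (anchor_defect_skew12 Y1 Y2) AA AB BB).
by move=> Z; exact: anchor_defect_add1.
Qed.

(** The Leibniz defect has no symmetry between its last argument and the first
    two, so the last argument is split by additivity alone. *)
Lemma leibniz_defect_vanish (S T : Type) (iA : S -> section A)
    (iB : T -> section A) f :
  (forall Z, exists x y, Z = iA x + iB y) ->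
  let D := leibniz_defect f in
  (forall x1 x2 x3, D (iA x1) (iA x2) (iA x3) = 0) ->
  (forall x1 x2 y3, D (iA x1) (iA x2) (iB y3) = 0) ->
  (forall x1 y2 x3, D (iA x1) (iB y2) (iA x3) = 0) ->
  (forall x1 y2 y3, D (iA x1) (iB y2) (iB y3) = 0) ->
  (forall y1 y2 x3, D (iB y1) (iB y2) (iA x3) = 0) ->
  (forall y1 y2 y3, D (iB y1) (iB y2) (iB y3) = 0) ->
  forall Z1 Z2 Y, D Z1 Z2 Y = 0.
Proof.
move=> span D D1 D2 D3 D4 D5 D6 Z1 Z2 Y; have [x [y ->]] := span Y.
rewrite /D leibniz_defect_add3.
have skew12 := leibniz_defect_skew12 f; have add1 := leibniz_defect_add1 f.
rewrite (skew2_vanish span (add1^~ _) (skew12 _)) // add0r.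
by rewrite (skew2_vanish span (add1^~ _) (skew12 _)).
Qed.

End AlgebroidDefects.

(** * The double cross bracket on pure sections *)

Section DoubleCrossProductBracket.
Set Implicit Arguments.
Unset Strict Implicit.
Import GRing.Theory.
Local Open Scope ring_scope.
Context {R : realType} {M : manifold R} {A B : anchored_bundle M}.
Implicit Types (X : section A) (eta : section B) (f : Cinfty M).

(** A named copy of [section_pair] whose type is that of sections of the
    anchored Whitney sum: the rewrite rules below are keyed on it. *)
Definition whitney_pair X eta : section (whitney_anchored A B) :=
  section_pair X eta.
Definition pureA X := whitney_pair X 0.
Definition pureB eta := whitney_pair 0 eta.

Lemma whitney_pair_span (Z : section (whitney_anchored A B)) :
  exists X eta, Z = pureA X + pureB eta.
Proof.
exists (section_fst Z), (section_snd Z).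
rewrite -[LHS]section_pair_eta; apply: section_ext => p /=.
by congr pair; rewrite /= ?addr0 ?add0r.
Qed.

Lemma whitney_pairD X X' eta eta' :
  whitney_pair X eta + whitney_pair X' eta'
  = whitney_pair (X + X') (eta + eta').
Proof. exact: section_ext. Qed.

Lemma whitney_pairN X eta : - whitney_pair X eta = whitney_pair (- X) (- eta).
Proof. exact: section_ext. Qed.

Lemma whitney_pairM f X eta :
  f *s whitney_pair X eta = whitney_pair (f *s X) (f *s eta).
Proof. exact: section_ext. Qed.

Lemma whitney_pair_inj X X' eta eta' :
  whitney_pair X eta = whitney_pair X' eta' <-> X = X' /\ eta = eta'.
Proof.
split=> [E|[-> ->] //]; have := section_pairK X eta.
by rewrite -/(whitney_pair X eta) E => -[<- <-];
  have [-> ->] := section_pairK X' eta'.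
Qed.

Lemma anchor_pair X X' eta eta' :
  anchor (whitney_pair X eta) (whitney_pair X' eta')
  = anchor X X' + anchor eta eta'.
Proof.
rewrite /anchor /= /whitney_pair.
by have [-> ->] := section_pairK X eta; have [-> ->] := section_pairK X' eta'.
Qed.

Context (phi : section A -> section A -> section A -> section A)
  (zeta : section A -> section A -> section A -> section B)
  (psi : section B -> section B -> section B -> section A)
  (theta : section B -> section B -> section B -> section B)
  (rho : section B -> section B -> section A -> section A)
  (sigma : section B -> section A -> section A -> section B).
Context (phi_tri : trilinear_map phi) (phi_skew : skew3 phi)
  (zeta_tri : trilinear_map zeta) (zeta_skew : skew3 zeta)
  (psi_tri : trilinear_map psi) (psi_skew : skew3 psi)
  (theta_tri : trilinear_map theta) (theta_skew : skew3 theta)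
  (rho_tri : trilinear_map rho)
  (rho_skew : forall eta1 eta2 X, rho eta1 eta2 X = - rho eta2 eta1 X)
  (sigma_tri : trilinear_map sigma)
  (sigma_skew : forall eta X1 X2, sigma eta X1 X2 = - sigma eta X2 X1).

Local Notation br := (double_cross_bracket phi zeta psi theta rho sigma).

Lemma bracket_pair X1 X2 X3 eta1 eta2 eta3 :
  br (whitney_pair X1 eta1) (whitney_pair X2 eta2) (whitney_pair X3 eta3) =
  whitney_pair (phi X1 X2 X3 + psi eta1 eta2 eta3
       + rho eta2 eta3 X1 - rho eta1 eta3 X2 + rho eta1 eta2 X3)
     (theta eta1 eta2 eta3 + zeta X1 X2 X3
       + sigma eta3 X1 X2 - sigma eta2 X1 X3 + sigma eta1 X2 X3).
Proof.
rewrite /double_cross_bracket /whitney_pair.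
by rewrite !(section_pairK _ _).1 !(section_pairK _ _).2.
Qed.

(* Shaped after the components of the bracket: of their five terms the fourth
   is subtracted. *)
Let linear_sum5 (V : lmodType R) a (x1 x2 x3 x4 x5 y1 y2 y3 y4 y5 : V) :
  (a *: x1 + y1) + (a *: x2 + y2) + (a *: x3 + y3) - (a *: x4 + y4)
    + (a *: x5 + y5)
  = a *: (x1 + x2 + x3 - x4 + x5) + (y1 + y2 + y3 - y4 + y5).
Proof.
rewrite !scalerDr scalerN (opprD _ y4) (addrACA _ y1) (addrACA _ (y1 + y2)).
by rewrite (addrACA _ (y1 + y2 + y3)) (addrACA _ (y1 + y2 + y3 - y4)).
Qed.

(** In each argument, each of the five terms of each component is linear in
    one slot of its map, composed with one of the two linear projections. *)
Lemma double_cross_bracket_trilinear : trilinear_map br.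
Proof.
have [p1 p2 p3] := phi_tri; have [z1 z2 z3] := zeta_tri.
have [q1 q2 q3] := psi_tri; have [t1 t2 t3] := theta_tri.
have [r1 r2 r3] := rho_tri; have [s1 s2 s3] := sigma_tri.
have mkL a X X' eta eta' :
    whitney_pair (a *: X + X') (a *: eta + eta')
    = a *: whitney_pair X eta + whitney_pair X' eta'.
  exact: section_ext.
split=> Z Z' a Y Y'; rewrite /double_cross_bracket -/(whitney_pair _ _) -mkL;
  rewrite (section_fst_linear a Y) (section_snd_linear a Y).
- by rewrite p1 q1 r3 r1 r1 t1 z1 s2 s2 s1 !linear_sum5.
- by rewrite p2 q2 r1 r3 r2 t2 z2 s3 s1 s2 !linear_sum5.
- by rewrite p3 q3 r2 r2 r3 t3 z3 s1 s3 s3 !linear_sum5.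
Qed.

(** Under an exchange of two neighbouring arguments one rho-term and one
    sigma-term change sign by skewness of rho and sigma, and the two other
    terms of the same kind change places. *)
Lemma double_cross_bracket_skew : skew3 br.
Proof.
move=> Z1 Z2 Z3; rewrite -(section_pair_eta Z1) -(section_pair_eta Z2).
rewrite -(section_pair_eta Z3).
set X1 := section_fst Z1; set X2 := section_fst Z2; set X3 := section_fst Z3.
set eta1 := section_snd Z1; set eta2 := section_snd Z2.
set eta3 := section_snd Z3.
split; rewrite -!/(whitney_pair _ _) !bracket_pair whitney_pairN;
  apply/whitney_pair_inj.
- rewrite (phi_skew X1 X2 X3).1 (psi_skew eta1 eta2 eta3).1.
  rewrite (rho_skew eta1 eta2).
  rewrite (theta_skew eta1 eta2 eta3).1 (zeta_skew X1 X2 X3).1.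
  rewrite (sigma_skew eta3 X1 X2) !opprD !opprK; split; last exact: addrAC.
  by congr (_ + _); exact: addrAC.
- rewrite (phi_skew X1 X2 X3).2 (psi_skew eta1 eta2 eta3).2.
  rewrite (rho_skew eta2 eta3).
  rewrite (theta_skew eta1 eta2 eta3).2 (zeta_skew X1 X2 X3).2.
  rewrite (sigma_skew eta1 X2 X3) !opprD !opprK; split; first exact: addrAC.
  by congr (_ + _); exact: addrAC.
Qed.

Let trilinear_zero := (trilinear0 phi_tri, trilinear0 zeta_tri,
  trilinear0 psi_tri, trilinear0 theta_tri, trilinear0 rho_tri,
  trilinear0 sigma_tri).
Let trilinear_opp := (trilinearN phi_tri, trilinearN zeta_tri,
  trilinearN psi_tri, trilinearN theta_tri, trilinearN rho_tri,
  trilinearN sigma_tri).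

Let anchor_zero := (bilinear0 (@anchor_bilinear _ _ A),
  bilinear0 (@anchor_bilinear _ _ B)).
Let anchor_opp := (bilinearN (@anchor_bilinear _ _ A),
  bilinearN (@anchor_bilinear _ _ B)).
Let simp0 := (trilinear_zero, trilinear_opp, anchor_zero, anchor_opp,
  (@lie_bracket0l _ M), (@lie_bracket0r _ M), (@vf_app0l _ M),
  (@section_mulr0 _ M), (@section_mulNr _ M), (@section_mul0r _ M),
  addr0, add0r, subr0, sub0r, oppr0).

(* Equalities between propositions, so that they rewrite inside conjunctions. *)
Let subr0E (V : zmodType) (x y : V) : (x - y = 0) = (x = y).
Proof. by apply/propext; split=> [/subr0_eq|->] //; rewrite subrr. Qed.

Let eq_symE (T : Type) (x y : T) : (x = y) = (y = x).
Proof. by apply/propext; split. Qed.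

Let eqr_oppE (V : zmodType) (x y : V) : (- x = y) = (x = - y).
Proof. by apply/propext; split=> [<-|->]; rewrite opprK. Qed.

Let eq0_oppD (V : zmodType) (x y : V) : (0 = - x + y) = (x - y = 0).
Proof. by rewrite addrC subr0E (eq_symE 0) subr0E (eq_symE y). Qed.

(* The three tactics below turn the vanishing of a defect at pure arguments
   into the conjunction of its A- and B-components.  The anchor defect is a
   vector field and has a single component. *)
Local Ltac eval_fundamental :=
  rewrite /fundamental_defect /pureA /pureB !bracket_pair !simp0;
  rewrite ?whitney_pairD ?simp0 subr0E whitney_pair_inj ?opprK ?addrA.

Local Ltac eval_anchor :=
  rewrite /anchor_defect /pureA /pureB !bracket_pair !simp0;
  rewrite !anchor_pair ?simp0 ?subr0E.

Local Ltac eval_leibniz :=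
  (* The bracket is evaluated before the scalars enter the pairs: otherwise the
     scalar rule would unfold the bracket itself. *)
  rewrite /leibniz_defect /pureA /pureB !bracket_pair !whitney_pairM !simp0;
  rewrite bracket_pair anchor_pair !simp0 ?whitney_pairD ?simp0;
  rewrite subr0E whitney_pair_inj.

(** In the names below the letters give the summands of the arguments of the
    defect: the acting pair, then the arguments that are acted on. *)
Lemma fundamental_AA_AAA X1 X2 X3 X4 X5 :
  fundamental_defect br (pureA X1) (pureA X2)
    (pureA X3) (pureA X4) (pureA X5) = 0 <->
  phi X1 X2 (phi X3 X4 X5) =
    phi (phi X1 X2 X3) X4 X5 + phi X3 (phi X1 X2 X4) X5
    + phi X3 X4 (phi X1 X2 X5) /\
  zeta X1 X2 (phi X3 X4 X5) + sigma (zeta X3 X4 X5) X1 X2 =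
    zeta (phi X1 X2 X3) X4 X5 + sigma (zeta X1 X2 X3) X4 X5
    + zeta X3 (phi X1 X2 X4) X5 - sigma (zeta X1 X2 X4) X3 X5
    + zeta X3 X4 (phi X1 X2 X5) + sigma (zeta X1 X2 X5) X3 X4.
Proof. by eval_fundamental. Qed.

Lemma fundamental_AA_AAB X1 X2 X3 X4 eta5 :
  fundamental_defect br (pureA X1) (pureA X2)
    (pureA X3) (pureA X4) (pureB eta5) = 0 <->
  rho (zeta X1 X2 X3) eta5 X4 - rho (zeta X1 X2 X4) eta5 X3 = 0 /\
  sigma (sigma eta5 X3 X4) X1 X2 =
    sigma eta5 (phi X1 X2 X3) X4 + sigma eta5 X3 (phi X1 X2 X4)
    + sigma (sigma eta5 X1 X2) X3 X4.
Proof. eval_fundamental; by rewrite eq0_oppD. Qed.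

Lemma fundamental_AA_ABB X1 X2 X3 eta4 eta5 :
  fundamental_defect br (pureA X1) (pureA X2)
    (pureA X3) (pureB eta4) (pureB eta5) = 0 <->
  phi X1 X2 (rho eta4 eta5 X3) =
    psi (zeta X1 X2 X3) eta4 eta5 + rho eta4 eta5 (phi X1 X2 X3)
    + rho (sigma eta4 X1 X2) eta5 X3 + rho eta4 (sigma eta5 X1 X2) X3 /\
  zeta X1 X2 (rho eta4 eta5 X3) = theta (zeta X1 X2 X3) eta4 eta5.
Proof. by eval_fundamental. Qed.

Lemma fundamental_AA_BBB X1 X2 eta3 eta4 eta5 :
  fundamental_defect br (pureA X1) (pureA X2)
    (pureB eta3) (pureB eta4) (pureB eta5) = 0 <->
  phi X1 X2 (psi eta3 eta4 eta5) =
    psi (sigma eta3 X1 X2) eta4 eta5 + psi eta3 (sigma eta4 X1 X2) eta5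
    + psi eta3 eta4 (sigma eta5 X1 X2) /\
  zeta X1 X2 (psi eta3 eta4 eta5) + sigma (theta eta3 eta4 eta5) X1 X2 =
    theta (sigma eta3 X1 X2) eta4 eta5 + theta eta3 (sigma eta4 X1 X2) eta5
    + theta eta3 eta4 (sigma eta5 X1 X2).
Proof. by eval_fundamental. Qed.

Lemma fundamental_AB_AAA X1 eta2 X3 X4 X5 :
  fundamental_defect br (pureA X1) (pureB eta2)
    (pureA X3) (pureA X4) (pureA X5) = 0 <->
  rho eta2 (zeta X3 X4 X5) X1 = 0 /\
  sigma eta2 X1 (phi X3 X4 X5) =
    sigma (sigma eta2 X1 X3) X4 X5 - sigma (sigma eta2 X1 X4) X3 X5
    + sigma (sigma eta2 X1 X5) X3 X4.
Proof. eval_fundamental; by rewrite eqr_oppE !opprD !opprK. Qed.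

Lemma fundamental_AB_AAB X1 eta2 X3 X4 eta5 :
  fundamental_defect br (pureA X1) (pureB eta2)
    (pureA X3) (pureA X4) (pureB eta5) = 0 <->
  rho eta2 (sigma eta5 X3 X4) X1 =
    rho (sigma eta2 X1 X3) eta5 X4 - rho (sigma eta2 X1 X4) eta5 X3
    + phi X3 X4 (rho eta2 eta5 X1) /\
  zeta X3 X4 (rho eta2 eta5 X1) = 0.
Proof. eval_fundamental; by rewrite (eq_symE 0). Qed.

Lemma fundamental_AB_ABB X1 eta2 X3 eta4 eta5 :
  fundamental_defect br (pureA X1) (pureB eta2)
    (pureA X3) (pureB eta4) (pureB eta5) = 0 <->
  psi (sigma eta2 X1 X3) eta4 eta5 = 0 /\
  sigma eta2 X1 (rho eta4 eta5 X3) =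
    theta (sigma eta2 X1 X3) eta4 eta5 - sigma eta5 X3 (rho eta2 eta4 X1)
    + sigma eta4 X3 (rho eta2 eta5 X1).
Proof.
eval_fundamental.
by rewrite (eq_symE 0) !eqr_oppE !opprD !opprK oppr0.
Qed.

Lemma fundamental_AB_BBB X1 eta2 eta3 eta4 eta5 :
  fundamental_defect br (pureA X1) (pureB eta2)
    (pureB eta3) (pureB eta4) (pureB eta5) = 0 <->
  rho eta2 (theta eta3 eta4 eta5) X1 =
    rho eta4 eta5 (rho eta2 eta3 X1) - rho eta3 eta5 (rho eta2 eta4 X1)
    + rho eta3 eta4 (rho eta2 eta5 X1) /\
  sigma eta2 (psi eta3 eta4 eta5) X1 = 0.
Proof.
eval_fundamental.
by rewrite eqr_oppE oppr0 (sigma_skew _ X1) eqr_oppE oppr0.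
Qed.

Lemma fundamental_BB_AAA eta1 eta2 X3 X4 X5 :
  fundamental_defect br (pureB eta1) (pureB eta2)
    (pureA X3) (pureA X4) (pureA X5) = 0 <->
  rho eta1 eta2 (phi X3 X4 X5) + psi eta1 eta2 (zeta X3 X4 X5) =
    phi (rho eta1 eta2 X3) X4 X5 + phi X3 (rho eta1 eta2 X4) X5
    + phi X3 X4 (rho eta1 eta2 X5) /\
  theta eta1 eta2 (zeta X3 X4 X5) =
    zeta (rho eta1 eta2 X3) X4 X5 + zeta X3 (rho eta1 eta2 X4) X5
    + zeta X3 X4 (rho eta1 eta2 X5).
Proof. eval_fundamental; by rewrite [psi _ _ _ + _]addrC. Qed.

Lemma fundamental_BB_AAB eta1 eta2 X3 X4 eta5 :
  fundamental_defect br (pureB eta1) (pureB eta2)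
    (pureA X3) (pureA X4) (pureB eta5) = 0 <->
  psi eta1 eta2 (sigma eta5 X3 X4) = phi X3 X4 (psi eta1 eta2 eta5) /\
  theta eta1 eta2 (sigma eta5 X3 X4) =
    sigma eta5 (rho eta1 eta2 X3) X4 + sigma eta5 X3 (rho eta1 eta2 X4)
    + zeta X3 X4 (psi eta1 eta2 eta5) + sigma (theta eta1 eta2 eta5) X3 X4.
Proof. by eval_fundamental. Qed.

Lemma fundamental_BB_ABB eta1 eta2 X3 eta4 eta5 :
  fundamental_defect br (pureB eta1) (pureB eta2)
    (pureA X3) (pureB eta4) (pureB eta5) = 0 <->
  rho eta1 eta2 (rho eta4 eta5 X3) =
    rho eta4 eta5 (rho eta1 eta2 X3) + rho (theta eta1 eta2 eta4) eta5 X3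
    + rho eta4 (theta eta1 eta2 eta5) X3 /\
  sigma eta5 X3 (psi eta1 eta2 eta4)
    - sigma eta4 X3 (psi eta1 eta2 eta5) = 0.
Proof. eval_fundamental; by rewrite (eq_symE 0). Qed.

Lemma fundamental_BB_BBB eta1 eta2 eta3 eta4 eta5 :
  fundamental_defect br (pureB eta1) (pureB eta2)
    (pureB eta3) (pureB eta4) (pureB eta5) = 0 <->
  psi eta1 eta2 (theta eta3 eta4 eta5) + rho eta1 eta2 (psi eta3 eta4 eta5) =
    psi (theta eta1 eta2 eta3) eta4 eta5 + rho eta4 eta5 (psi eta1 eta2 eta3)
    + psi eta3 (theta eta1 eta2 eta4) eta5 - rho eta3 eta5 (psi eta1 eta2 eta4)
    + psi eta3 eta4 (theta eta1 eta2 eta5)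
    + rho eta3 eta4 (psi eta1 eta2 eta5) /\
  theta eta1 eta2 (theta eta3 eta4 eta5) =
    theta (theta eta1 eta2 eta3) eta4 eta5
    + theta eta3 (theta eta1 eta2 eta4) eta5
    + theta eta3 eta4 (theta eta1 eta2 eta5).
Proof. by eval_fundamental. Qed.

Lemma anchor_AA_AA X1 X2 X3 X4 :
  anchor_defect br (pureA X1) (pureA X2) (pureA X3) (pureA X4) = 0 <->
  lie_bracket (anchor X1 X2) (anchor X3 X4) =
    anchor (phi X1 X2 X3) X4 + anchor X3 (phi X1 X2 X4).
Proof. eval_anchor; by rewrite eq_symE. Qed.

Lemma anchor_AA_AB X1 X2 X3 eta4 :
  anchor_defect br (pureA X1) (pureA X2) (pureA X3) (pureB eta4) = 0 <->
  anchor (zeta X1 X2 X3) eta4 = 0.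
Proof. by eval_anchor. Qed.

Lemma anchor_AA_BB X1 X2 eta3 eta4 :
  anchor_defect br (pureA X1) (pureA X2) (pureB eta3) (pureB eta4) = 0 <->
  lie_bracket (anchor X1 X2) (anchor eta3 eta4) =
    anchor (sigma eta3 X1 X2) eta4 + anchor eta3 (sigma eta4 X1 X2).
Proof. eval_anchor; by rewrite eq_symE. Qed.

Lemma anchor_AB_AB X1 eta2 X3 eta4 :
  anchor_defect br (pureA X1) (pureB eta2) (pureA X3) (pureB eta4) = 0 <->
  anchor (sigma eta2 X1 X3) eta4 - anchor X3 (rho eta2 eta4 X1) = 0.
Proof. eval_anchor; by rewrite addrC subr0E eq_symE. Qed.

Lemma anchor_BB_AA eta1 eta2 X3 X4 :
  anchor_defect br (pureB eta1) (pureB eta2) (pureA X3) (pureA X4) = 0 <->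
  lie_bracket (anchor eta1 eta2) (anchor X3 X4) =
    anchor (rho eta1 eta2 X3) X4 + anchor X3 (rho eta1 eta2 X4).
Proof. eval_anchor; by rewrite eq_symE. Qed.

Lemma anchor_BB_AB eta1 eta2 X3 eta4 :
  anchor_defect br (pureB eta1) (pureB eta2) (pureA X3) (pureB eta4) = 0 <->
  anchor X3 (psi eta1 eta2 eta4) = 0.
Proof. by eval_anchor. Qed.

Lemma anchor_BB_BB eta1 eta2 eta3 eta4 :
  anchor_defect br (pureB eta1) (pureB eta2) (pureB eta3) (pureB eta4) = 0 <->
  lie_bracket (anchor eta1 eta2) (anchor eta3 eta4) =
    anchor (theta eta1 eta2 eta3) eta4 + anchor eta3 (theta eta1 eta2 eta4).
Proof. eval_anchor; by rewrite eq_symE. Qed.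

Lemma anchor_AB_AA X1 eta2 X3 X4 :
  anchor_defect br (pureA X1) (pureB eta2) (pureA X3) (pureA X4) = 0.
Proof. by eval_anchor. Qed.

Lemma anchor_AB_BB X1 eta2 eta3 eta4 :
  anchor_defect br (pureA X1) (pureB eta2) (pureB eta3) (pureB eta4) = 0.
Proof. by eval_anchor. Qed.

Lemma leibniz_AA_A f X1 X2 X3 :
  leibniz_defect br f (pureA X1) (pureA X2) (pureA X3) = 0 <->
  phi X1 X2 (f *s X3) = f *s phi X1 X2 X3 + vf_app (anchor X1 X2) f *s X3 /\
  zeta X1 X2 (f *s X3) = f *s zeta X1 X2 X3.
Proof. by eval_leibniz. Qed.

Lemma leibniz_AA_B f X1 X2 eta3 :
  leibniz_defect br f (pureA X1) (pureA X2) (pureB eta3) = 0 <->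
  sigma (f *s eta3) X1 X2 =
    f *s sigma eta3 X1 X2 + vf_app (anchor X1 X2) f *s eta3.
Proof. eval_leibniz; by split=> [[]|]. Qed.

Lemma leibniz_AB_A f X1 eta2 X3 :
  leibniz_defect br f (pureA X1) (pureB eta2) (pureA X3) = 0 <->
  sigma eta2 X1 (f *s X3) = f *s sigma eta2 X1 X3.
Proof. eval_leibniz; by rewrite eqr_oppE opprK; split=> [[]|]. Qed.

Lemma leibniz_AB_B f X1 eta2 eta3 :
  leibniz_defect br f (pureA X1) (pureB eta2) (pureB eta3) = 0 <->
  rho eta2 (f *s eta3) X1 = f *s rho eta2 eta3 X1.
Proof. eval_leibniz; by split=> [[]|]. Qed.

Lemma leibniz_BB_A f eta1 eta2 X3 :
  leibniz_defect br f (pureB eta1) (pureB eta2) (pureA X3) = 0 <->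
  rho eta1 eta2 (f *s X3) =
    f *s rho eta1 eta2 X3 + vf_app (anchor eta1 eta2) f *s X3.
Proof. eval_leibniz; by split=> [[]|]. Qed.

Lemma leibniz_BB_B f eta1 eta2 eta3 :
  leibniz_defect br f (pureB eta1) (pureB eta2) (pureB eta3) = 0 <->
  psi eta1 eta2 (f *s eta3) = f *s psi eta1 eta2 eta3 /\
  theta eta1 eta2 (f *s eta3) =
    f *s theta eta1 eta2 eta3 + vf_app (anchor eta1 eta2) f *s eta3.
Proof. by eval_leibniz. Qed.

(** * The axioms in terms of the components *)

Let br_tri := double_cross_bracket_trilinear.
Let br_skew := double_cross_bracket_skew.

Lemma fundamental_identityP :
  (forall Z1 Z2 Y1 Y2 Y3, fundamental_defect br Z1 Z2 Y1 Y2 Y3 = 0) <->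
  homogeneous_conditions phi zeta psi theta rho sigma /\
  conditions_AAAAB phi zeta rho sigma /\
  conditions_AAABB phi zeta psi theta rho sigma /\
  conditions_AABBB phi zeta psi theta rho sigma /\
  conditions_ABBBB psi theta rho sigma.
Proof.
split=> [FI|].
  split; [|split; [|split; [|split]]]; do ?[apply: conj] => *.
  - exact: ((fundamental_AA_AAA _ _ _ _ _).1 (FI _ _ _ _ _)).1.
  - exact: ((fundamental_AA_AAA _ _ _ _ _).1 (FI _ _ _ _ _)).2.
  - exact: ((fundamental_BB_BBB _ _ _ _ _).1 (FI _ _ _ _ _)).2.
  - exact: ((fundamental_BB_BBB _ _ _ _ _).1 (FI _ _ _ _ _)).1.
  - exact: ((fundamental_AA_AAB _ _ _ _ _).1 (FI _ _ _ _ _)).2.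
  - exact: ((fundamental_AA_AAB _ _ _ _ _).1 (FI _ _ _ _ _)).1.
  - exact: ((fundamental_AB_AAA _ _ _ _ _).1 (FI _ _ _ _ _)).2.
  - exact: ((fundamental_AB_AAA _ _ _ _ _).1 (FI _ _ _ _ _)).1.
  - exact: ((fundamental_AA_ABB _ _ _ _ _).1 (FI _ _ _ _ _)).1.
  - exact: ((fundamental_AA_ABB _ _ _ _ _).1 (FI _ _ _ _ _)).2.
  - exact: ((fundamental_AB_AAB _ _ _ _ _).1 (FI _ _ _ _ _)).1.
  - exact: ((fundamental_AB_AAB _ _ _ _ _).1 (FI _ _ _ _ _)).2.
  - exact: ((fundamental_BB_AAA _ _ _ _ _).1 (FI _ _ _ _ _)).1.
  - exact: ((fundamental_BB_AAA _ _ _ _ _).1 (FI _ _ _ _ _)).2.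
  - exact: ((fundamental_AA_BBB _ _ _ _ _).1 (FI _ _ _ _ _)).1.
  - exact: ((fundamental_AA_BBB _ _ _ _ _).1 (FI _ _ _ _ _)).2.
  - exact: ((fundamental_AB_ABB _ _ _ _ _).1 (FI _ _ _ _ _)).2.
  - exact: ((fundamental_AB_ABB _ _ _ _ _).1 (FI _ _ _ _ _)).1.
  - exact: ((fundamental_BB_AAB _ _ _ _ _).1 (FI _ _ _ _ _)).1.
  - exact: ((fundamental_BB_AAB _ _ _ _ _).1 (FI _ _ _ _ _)).2.
  - exact: ((fundamental_AB_BBB _ _ _ _ _).1 (FI _ _ _ _ _)).1.
  - exact: ((fundamental_AB_BBB _ _ _ _ _).1 (FI _ _ _ _ _)).2.
  - exact: ((fundamental_BB_ABB _ _ _ _ _).1 (FI _ _ _ _ _)).1.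
  - exact: ((fundamental_BB_ABB _ _ _ _ _).1 (FI _ _ _ _ _)).2.
case=> [[a1 [a2 [a3 a4]]] [[b1 [b2 [b3 b4]]] [[c1 [c2 [c3 [c4 [c5 c6]]]]]
  [[d1 [d2 [d3 [d4 [d5 d6]]]]] [e1 [e2 [e3 e4]]]]]]].
apply: (fundamental_defect_vanish br_tri br_skew whitney_pair_span) => *.
- by apply/fundamental_AA_AAA; split.
- by apply/fundamental_AA_AAB; split.
- by apply/fundamental_AA_ABB; split.
- by apply/fundamental_AA_BBB; split.
- by apply/fundamental_AB_AAA; split.
- by apply/fundamental_AB_AAB; split.
- by apply/fundamental_AB_ABB; split.
- by apply/fundamental_AB_BBB; split.
- by apply/fundamental_BB_AAA; split.
- by apply/fundamental_BB_AAB; split.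
- by apply/fundamental_BB_ABB; split.
- by apply/fundamental_BB_BBB; split.
Qed.

Lemma anchor_identityP :
  (forall Z1 Z2 Y1 Y2, anchor_defect br Z1 Z2 Y1 Y2 = 0) <->
  anchor_conditions phi zeta psi theta rho sigma.
Proof.
split=> [AI|[AA_AA [AA_AB [AA_BB [AB_AB [BB_AA [BB_AB BB_BB]]]]]]].
  do ?[apply: conj] => *.
  - by apply/anchor_AA_AA; exact: AI.
  - by apply/anchor_AA_AB; exact: AI.
  - by apply/anchor_AA_BB; exact: AI.
  - by apply/anchor_AB_AB; exact: AI.
  - by apply/anchor_BB_AA; exact: AI.
  - by apply/anchor_BB_AB; exact: AI.
  - by apply/anchor_BB_BB; exact: AI.
apply: (anchor_defect_vanish br_tri br_skew whitney_pair_span) => *.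
- by apply/anchor_AA_AA.
- by apply/anchor_AA_AB.
- by apply/anchor_AA_BB.
- exact: anchor_AB_AA.
- by apply/anchor_AB_AB.
- exact: anchor_AB_BB.
- by apply/anchor_BB_AA.
- by apply/anchor_BB_AB.
- by apply/anchor_BB_BB.
Qed.

Lemma leibniz_ruleP :
  (forall f Z1 Z2 Y, leibniz_defect br f Z1 Z2 Y = 0) <->
  leibniz_conditions phi zeta psi theta rho sigma.
Proof.
split=> [LR|[l1 [l2 [l3 [l4 [l5 [l6 [l7 l8]]]]]]] f].
  do ?[apply: conj] => *.
  - exact: ((leibniz_AA_A _ _ _ _).1 (LR _ _ _ _)).1.
  - exact: ((leibniz_AA_A _ _ _ _).1 (LR _ _ _ _)).2.
  - by apply/leibniz_AA_B; exact: LR.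
  - by apply/leibniz_AB_A; exact: LR.
  - rewrite rho_skew ((leibniz_AB_B _ _ _ _).1 (LR _ _ _ _)).
    by rewrite -section_mulNr -rho_skew.
  - by apply/leibniz_BB_A; exact: LR.
  - exact: ((leibniz_BB_B _ _ _ _).1 (LR _ _ _ _)).1.
  - exact: ((leibniz_BB_B _ _ _ _).1 (LR _ _ _ _)).2.
apply: (leibniz_defect_vanish br_tri br_skew whitney_pair_span) => *.
- by apply/leibniz_AA_A; split.
- by apply/leibniz_AA_B.
- by apply/leibniz_AB_A.
(* Condition l5 scales the first argument of rho, and the defect the second. *)
- by apply/leibniz_AB_B; rewrite rho_skew l5 -section_mulNr -rho_skew.
- by apply/leibniz_BB_A.
- by apply/leibniz_BB_B; split.
Qed.

End DoubleCrossProductBracket.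

Theorem proposition3p1 (R : realType) (M : manifold R) (A B : anchored_bundle M)
  (phi : section A -> section A -> section A -> section A)
  (zeta : section A -> section A -> section A -> section B)
  (psi : section B -> section B -> section B -> section A)
  (theta : section B -> section B -> section B -> section B)
  (rho : section B -> section B -> section A -> section A)
  (sigma : section B -> section A -> section A -> section B)
  (phi_tri : trilinear_map phi) (phi_skew : skew3 phi)
  (zeta_tri : trilinear_map zeta) (zeta_skew : skew3 zeta)
  (psi_tri : trilinear_map psi) (psi_skew : skew3 psi)
  (theta_tri : trilinear_map theta) (theta_skew : skew3 theta)
  (rho_tri : trilinear_map rho)
  (rho_skew : forall eta1 eta2 X, rho eta1 eta2 X = (- rho eta2 eta1 X)%R)
  (sigma_tri : trilinear_map sigma)
  (sigma_skew : forall eta X1 X2, sigma eta X1 X2 = (- sigma eta X2 X1)%R) :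
  is_3_Lie_algebroid (double_cross_bracket phi zeta psi theta rho sigma)
  <->
  anchor_conditions phi zeta psi theta rho sigma /\
  homogeneous_conditions phi zeta psi theta rho sigma /\
  conditions_AAAAB phi zeta rho sigma /\
  conditions_AAABB phi zeta psi theta rho sigma /\
  conditions_AABBB phi zeta psi theta rho sigma /\
  conditions_ABBBB psi theta rho sigma /\
  leibniz_conditions phi zeta psi theta rho sigma.
Proof.
have br_tri := double_cross_bracket_trilinear phi_tri zeta_tri psi_tri
  theta_tri rho_tri sigma_tri.
have br_skew := double_cross_bracket_skew phi_skew zeta_skew psi_skew
  theta_skew rho_skew sigma_skew.
have fundP := fundamental_identityP phi_tri phi_skew zeta_tri zeta_skew psi_tri
  psi_skew theta_tri theta_skew rho_tri rho_skew sigma_tri sigma_skew.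
have anchorP := anchor_identityP phi_tri phi_skew zeta_tri zeta_skew psi_tri
  psi_skew theta_tri theta_skew rho_tri rho_skew sigma_tri sigma_skew.
have leibP := leibniz_ruleP phi_tri phi_skew zeta_tri zeta_skew psi_tri
  psi_skew theta_tri theta_skew rho_tri rho_skew sigma_tri sigma_skew.
split=> [[_ ax_anchor ax_fund ax_leib]|[condI [condII [condIII [condIV
    [condV [condVI condVII]]]]]]].
  split; first apply/anchorP => *.
    by rewrite /anchor_defect ax_anchor GRing.subrr.
  have [|? [? [? [? ?]]]] := fundP.1.
    by move=> *; rewrite /fundamental_defect ax_fund GRing.subrr.
  do 5!split=> //; apply/leibP => *.
  by rewrite /leibniz_defect ax_leib GRing.subrr.
split=> // *; apply: GRing.subr0_eq.
- exact: anchorP.2.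
- by apply: fundP.2.
- exact: leibP.2.
Qed.
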